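(* Fix $0<d<1$. For every nonempty open set $\Omega\subset[0,2\pi]$ there exists a set $\Gamma\subset\mathbb{Z}$ of uniform density $D(\Gamma)>(1-d)|\Omega|$ such that \[ C(d)\,|\Omega|\sum_{\gamma\in\Gamma}|a_\gamma|^2\le \Big\|\sum_{\gamma\in\Gamma}a_\gamma e^{i\gamma t}\Big\|_{L^2(\Omega)}^2\qquad\text{for all }(a_\gamma)\in\ell^2(\Gamma), \] where $C(d)=(1-\sqrt{1-d})^2$.
   Context: $|\Omega|$ denotes the normalized Lebesgue measure on $[0,2\pi]$, i.e. $|\Omega|=\frac{1}{2\pi}\mathrm{Leb}(\Omega)$, and the norm of $L^2(\Omega)$ is taken with respect to this normalized measure. For $\Gamma\subset\mathbb{Z}$, $D^-(\Gamma)=\lim_{r\to\infty}\frac{\min_{x\in\mathbb{R}}|\Gamma\cap[x,x+r]|}{r}$ and $D^+(\Gamma)=\lim_{r\to\infty}\frac{\max_{x\in\mathbb{R}}|\Gamma\cap[x,x+r]|}{r}$ ($|\cdot|$ of a finite set is its cardinality); $\Gamma$ has uniform density $D(\Gamma)$ if $D^-(\Gamma)=D^+(\Gamma)=:D(\Gamma)$. *)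

(* Defs.v *)
From HB Require Import structures.
From mathcomp Require Import all_boot all_order all_algebra.
From mathcomp Require Import all_classical all_reals all_analysis.
Set Implicit Arguments. Unset Strict Implicit. Unset Printing Implicit Defensive.
Import Order.TTheory GRing.Theory Num.Theory.
Import numFieldNormedType.Exports.
Local Open Scope classical_set_scope.
Local Open Scope ring_scope.

Section Defs.
Variable R : realType.

(* Number of elements of Gamma (a set of integers) in the real interval [x, x+r]:
   the integers in [x, x+r] are ceil x, ceil x + 1, ..., floor (x + r). *)
Definition count_in (Gamma : set int) (x r : R) : R :=
  let lo := Num.ceil x in
  let hi := Num.floor (x + r) in
  \sum_(0 <= i < absz (Num.max 0%R (hi - lo + 1)%R))
     (if `[< Gamma (lo + i%:Z)%R >] then 1 else 0).

Definition min_count (Gamma : set int) (r : R) : R :=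
  inf [set count_in Gamma x r | x in setT].
Definition max_count (Gamma : set int) (r : R) : R :=
  sup [set count_in Gamma x r | x in setT].

Definition has_uniform_density (Gamma : set int) (D : R) : Prop :=
  (fun r => min_count Gamma r / r) @ +oo --> D /\
  (fun r => max_count Gamma r / r) @ +oo --> D.

Definition nmeasure (Omega : set R) : R :=
  fine (lebesgue_measure Omega) / (2 * pi).

(* |sum_{k=-N}^{N} a_k e^{ikt}|^2 with a_k = ar k + i ai k. *)
Definition partial_sum_sqnorm (ar ai : int -> R) (N : nat) (t : R) : R :=
  let k (j : nat) : int := (j%:Z - N%:Z)%R in
  (\sum_(0 <= j < N.*2.+1)
      (ar (k j) * cos ((k j)%:~R * t) - ai (k j) * sin ((k j)%:~R * t))) ^+ 2
  + (\sum_(0 <= j < N.*2.+1)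
      (ar (k j) * sin ((k j)%:~R * t) + ai (k j) * cos ((k j)%:~R * t))) ^+ 2.

Definition partial_L2sq (Omega : set R) (ar ai : int -> R) (N : nat) : R :=
  fine (\int[lebesgue_measure]_(t in Omega) (partial_sum_sqnorm ar ai N t)%:E)
    / (2 * pi).

Definition l2sq (Gamma : set int) (ar ai : int -> R) : \bar R :=
  (\esum_(k in Gamma) ((ar k) ^+ 2 + (ai k) ^+ 2)%:E)%E.

End Defs.

(* Main.v *)
(** Cut [0, 2 pi] into m equal cells and let E be the set of cells contained in
    Omega, so that #|E| / m is almost |Omega|. For a set Gamma = sigma + mZ the
    claim reduces, by sampling at the m translates of a point by 2 pi / m, to a
    lower bound for the compression to the coordinates in sigma of the projection
    P = W^* 1_E W / m, where W is the m x m Fourier matrix.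

    Such a sigma is found by deleting indices one at a time while a barrier b moves
    up by delta. Let N be the inverse of the compression of P - b. Moving the
    barrier increases tr N; deleting the index i decreases it by (N^2)_ii / N_ii,
    and some i achieves at least the average tr N^2 / tr N. If delta * tr N < 1 at
    the start, then tr N never exceeds its initial value, which is explicit because
    P is a projection of trace #|E|. Starting at b = - (1 - r) / r with
    r^2 = 1 - d, the barrier reaches (1 - r)^2 |Omega| / (1 - r |Omega|) when
    #|sigma| = r^2 |Omega| m, up to the approximation errors. This strictly exceeds
    (1 - r)^2 |Omega|, and the difference pays for replacing Omega by the union of
    cells and for making the density strictly larger than (1 - d) |Omega|. *)

Require Import Defs.
From HB Require Import structures.
From mathcomp Require Import all_boot all_order all_algebra.
From mathcomp Require Import all_classical all_reals all_analysis.
From mathcomp Require Import measurable_realfun complex ring lra zify.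
Set Implicit Arguments. Unset Strict Implicit. Unset Printing Implicit Defensive.
Import Order.TTheory GRing.Theory Num.Theory.
Import numFieldNormedType.Exports.
Local Open Scope ring_scope.

(** * Restricted invertibility of a projection *)

Section Adjoint.
Variable C : numClosedFieldType.

Definition adjmx m n (A : 'M[C]_(m, n)) : 'M[C]_(n, m) := map_mx Num.conj A^T.

Lemma adjmxE m n (A : 'M[C]_(m, n)) i j : adjmx A i j = (A j i)^*.
Proof. by rewrite !mxE. Qed.

Lemma adjmxK m n (A : 'M[C]_(m, n)) : adjmx (adjmx A) = A.
Proof. by apply/matrixP => i j; rewrite !mxE conjCK. Qed.

Lemma adjmxM m n p (A : 'M[C]_(m, n)) (B : 'M[C]_(n, p)) :
  adjmx (A *m B) = adjmx B *m adjmx A.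
Proof. by rewrite /adjmx trmx_mul map_mxM. Qed.

Lemma adjmxD m n (A B : 'M[C]_(m, n)) : adjmx (A + B) = adjmx A + adjmx B.
Proof. by rewrite /adjmx linearD map_mxD. Qed.

Lemma adjmxB m n (A B : 'M[C]_(m, n)) : adjmx (A - B) = adjmx A - adjmx B.
Proof. by apply/matrixP => i j; rewrite !mxE rmorphB. Qed.

Lemma adjmxZ m n a (A : 'M[C]_(m, n)) : adjmx (a *: A) = a^* *: adjmx A.
Proof. by apply/matrixP => i j; rewrite !mxE rmorphM. Qed.

Lemma adjmx_scalar n (a : C) : adjmx (a%:M : 'M[C]_n) = (a^*)%:M.
Proof.
by apply/matrixP => i j; rewrite !mxE rmorphMn /= eq_sym.
Qed.

Lemma adjmx_delta m n i j :
  adjmx (delta_mx i j : 'M[C]_(m, n)) = delta_mx j i.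
Proof. by apply/matrixP => a b; rewrite !mxE rmorph_nat andbC. Qed.

Lemma adjmx_inv n (A : 'M[C]_n) : adjmx (invmx A) = invmx (adjmx A).
Proof. by rewrite /adjmx trmx_inv map_invmx. Qed.

Lemma adjmx_mul_ge0 n (v : 'cV[C]_n) : 0 <= (adjmx v *m v) 0 0.
Proof.
rewrite mxE; apply: sumr_ge0 => i _; rewrite !mxE mulrC; exact: mul_conjC_ge0.
Qed.

Lemma adjmx_mul_eq0 n (v : 'cV[C]_n) : (adjmx v *m v) 0 0 = 0 -> v = 0.
Proof.
rewrite mxE => /eqP; rewrite psumr_eq0 => [/allP v0|i _]; last first.
  by rewrite !mxE mulrC mul_conjC_ge0.
apply/matrixP => i j; rewrite ord1 mxE; apply/eqP.
have := v0 i (mem_index_enum _).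
by rewrite /= !mxE mulrC mul_conjC_eq0.
Qed.

(** * Positive semidefinite matrices and Cauchy-Schwarz *)

Section Form.
Variables (n : nat) (N : 'M[C]_n).

Definition qform (v : 'cV[C]_n) : C := (adjmx v *m N *m v) 0 0.
Definition psdmx : Prop := adjmx N = N /\ forall v, 0 <= qform v.

Hypothesis psdN : psdmx.

Lemma psdmx_conj (u v : 'cV[C]_n) : (adjmx v *m N *m u) 0 0 = ((adjmx u *m N *m v) 0 0)^*.
Proof. by rewrite -adjmxE !adjmxM adjmxK psdN.1 mulmxA. Qed.

(** The form at [a *: u + b *: v], expanded; Cauchy-Schwarz needs two different choices of the
    coefficients. *)
Lemma psdmx_comb_ge0 (a b : C) (u v : 'cV[C]_n) :
  0 <= a * a^* * qform u + a^* * b * (adjmx u *m N *m v) 0 0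
       + a * b^* * (adjmx v *m N *m u) 0 0 + b * b^* * qform v.
Proof.
have := psdN.2 (a *: u + b *: v); rewrite /qform adjmxD !adjmxZ.
have addE m p (A B : 'M[C]_(m, p)) i j : (A + B) i j = A i j + B i j by rewrite mxE.
have scaleE m p c (A : 'M[C]_(m, p)) i j : (c *: A) i j = c * A i j by rewrite mxE.
rewrite !(mulmxDl, mulmxDr, =^~ scalemxAl, =^~ scalemxAr, addE, scaleE).
congr (_ <= _); ring.
Qed.

Lemma psdmx_CauchySchwarz (u v : 'cV[C]_n) :
  `|(adjmx u *m N *m v) 0 0| ^+ 2 <= qform u * qform v.
Proof.
set z := (adjmx u *m N *m v) 0 0.
have vu : (adjmx v *m N *m u) 0 0 = z^* by rewrite psdmx_conj.
have cr : (qform v)^* = qform v by apply/CrealP/ger0_real/psdN.2.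
have [v0|v0] := eqVneq (qform v) 0.
  rewrite v0 mulr0.
  have [->|z0] := eqVneq z 0; first by rewrite normr0 expr0n.
  have zz0 : 0 < z * z^* by rewrite mul_conjC_gt0.
  have ha0 := psdN.2 u.
  have sr : ((qform u + 1) / (z * z^*))^* = (qform u + 1) / (z * z^*).
    by apply/CrealP/ger0_real; rewrite divr_ge0 ?addr_ge0 // ltW.
  (* If [qform v = 0] but [z] is nonzero, a large enough multiple of [v] makes the form negative:
     this coefficient gives exactly [- (qform u + 2)]. *)
  have := psdmx_comb_ge0 1 (- ((qform u + 1) / (z * z^*) * z^*)) u v.
  rewrite vu v0 -/z rmorphN rmorphM /= sr conjCK rmorph1.
  set X := (X in 0 <= X).
  have -> : X = - (qform u + 2).
    by rewrite /X; field; rewrite ?conjC_eq0 z0.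
  by rewrite oppr_ge0 => /(le_trans (_ : 2 <= qform u + 2));
    rewrite lerDr => /(_ ha0); rewrite lern0.
have c0 : 0 < qform v by rewrite lt_neqAle eq_sym v0 psdN.2.
have := psdmx_comb_ge0 (qform v) (- z^*) u v.
rewrite vu -/z rmorphN /= conjCK cr normCK.
set X := (X in 0 <= X).
have -> : X = qform v * (qform u * qform v - z * z^*) by rewrite /X; ring.
by rewrite pmulr_rge0 // subr_ge0.
Qed.

Lemma qform_delta i : qform (delta_mx i 0) = N i i.
Proof.
by rewrite /qform adjmx_delta -rowE -colE !mxE.
Qed.

Lemma psdmx_diag_ge0 i : 0 <= N i i.
Proof. by rewrite -qform_delta psdN.2. Qed.

Lemma adj_delta_mul (v : 'cV[C]_n) i :
  (adjmx (delta_mx i 0 : 'cV[C]_n) *m N *m v) 0 0 = (N *m v) i 0.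
Proof.
by rewrite adjmx_delta -mulmxA -rowE mxE.
Qed.

Lemma psdmx_entry_le i (v : 'cV[C]_n) : `|(N *m v) i 0| ^+ 2 <= N i i * qform v.
Proof. by rewrite -adj_delta_mul -qform_delta psdmx_CauchySchwarz. Qed.

(** Summing [psdmx_entry_le] over the coordinates gives [N^2 <= \tr N * N] as forms. It lets the
    trace stand in for the largest eigenvalue, so no diagonalization is used. *)
Lemma psdmx_sqnorm_le (v : 'cV[C]_n) :
  (adjmx (N *m v) *m (N *m v)) 0 0 <= \tr N * qform v.
Proof.
rewrite mxE mulr_suml; apply: ler_sum => i _.
by rewrite adjmxE mulrC -normCK psdmx_entry_le.
Qed.

Lemma psdmx_tr_ge0 : 0 <= \tr N.
Proof. by apply: sumr_ge0 => i _; exact: psdmx_diag_ge0. Qed.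

Lemma psdmx_tr_conj_ge0 (K : 'M[C]_n) : 0 <= \tr (adjmx K *m N *m K).
Proof.
apply: sumr_ge0 => i _; have := psdN.2 (col i K); rewrite /qform.
congr (_ <= _); rewrite colE adjmxM -!mulmxA.
by rewrite adjmx_delta -rowE !mulmxA -colE !mxE; apply: eq_bigr => j _; rewrite !mxE.
Qed.

Lemma psdmx_tr_eq0 : \tr N = 0 -> N = 0.
Proof.
move=> tr0; have Nv0 (v : 'cV[C]_n) : N *m v = 0.
  apply: adjmx_mul_eq0; apply/le_anti; rewrite adjmx_mul_ge0 andbT.
  by rewrite (le_trans (psdmx_sqnorm_le v)) // tr0 mul0r.
apply/matrixP => i j; have := Nv0 (delta_mx j 0); rewrite -colE.
by move=> /matrixP /(_ i 0); rewrite !mxE.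
Qed.

End Form.

(** * Moving the barrier *)

Section Shift.
Variables (n : nat) (N : 'M[C]_n) (delta : C).
Hypotheses (psdN : psdmx N) (delta0 : 0 <= delta) (delta1 : delta * \tr N < 1).

Let B := 1%:M - delta *: N.

(** When [N] inverts [M], this inverts [M - delta]. The formula keeps its sense for singular [N],
    which occurs as soon as one index has been deleted. *)
Definition shiftmx := N *m invmx B.

(** If [v = delta N v], then [|v|^2 = delta^2 |N v|^2 <= delta * \tr N * |v|^2] by
    [psdmx_sqnorm_le], so [v = 0] because [delta * \tr N < 1]. *)
Lemma shift_unit : B \in unitmx.
Proof.
rewrite -unitmx_tr -row_free_unit; apply/row_freeP.
suff : row_free B^T by move/row_freeP.
rewrite -kermx_eq0; apply/eqP/row_matrixP => i; rewrite row0.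
set w := row i _.
have wB : w *m B^T = 0.
  by apply/sub_kermxP; rewrite row_sub.
pose v := w^T.
have Bv : B *m v = 0 by rewrite -[LHS]trmxK trmx_mul trmxK wB trmx0.
suff v0 : v = 0 by rewrite -[w]trmxK -/v v0 trmx0.
have vE : v = delta *: (N *m v).
  by apply/eqP; rewrite -subr_eq0 scalemxAl -[X in X - _]mul1mx -mulmxBl Bv.
have dr : delta^* = delta by apply/CrealP/ger0_real.
apply: adjmx_mul_eq0.
have v1 : (adjmx v *m v) 0 0 = delta * qform N v.
  by rewrite [X in _ *m X]vE -scalemxAr mulmxA mxE.
have v2 : (adjmx v *m v) 0 0 <= delta * \tr N * (adjmx v *m v) 0 0.
  rewrite {2}v1 -[leLHS]/((adjmx v *m v) 0 0).
  have -> : (adjmx v *m v) 0 0 = delta * (delta * (adjmx (N *m v) *m (N *m v)) 0 0).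
    transitivity ((adjmx (delta *: (N *m v)) *m (delta *: (N *m v))) 0 0).
      by rewrite -vE.
    by rewrite adjmxZ dr -scalemxAl -scalemxAr !mxE.
  by rewrite -mulrA [\tr N * _]mulrCA !ler_wpM2l // psdmx_sqnorm_le.
have := adjmx_mul_ge0 v; rewrite le_eqVlt => /predU1P[<-//|vgt0].
by move: v2; rewrite ler_pMl // => /(lt_le_trans delta1); rewrite ltxx.
Qed.

Lemma shiftmx_comm : invmx B *m N = N *m invmx B.
Proof.
have BN : B *m N = N *m B.
  by rewrite mulmxBl mulmxBr mul1mx mulmx1 -scalemxAl -scalemxAr.
by rewrite -[LHS](mulmxK shift_unit) -(mulmxA (invmx B)) -BN (mulKmx shift_unit).
Qed.

Lemma shiftmxE : shiftmx = N + delta *: (N *m shiftmx).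
Proof.
rewrite /shiftmx [in RHS]mulmxA scalemxAl -{2}[N](mulmxK shift_unit).
by rewrite -mulmxDl mulmxBr mulmx1 -scalemxAr subrK.
Qed.

Lemma shiftmx_commN : shiftmx *m N = N *m shiftmx.
Proof. by rewrite /shiftmx -mulmxA shiftmx_comm. Qed.

Lemma adj_shift : adjmx B = B.
Proof.
rewrite adjmxB adjmxZ psdN.1 adjmx_scalar rmorph1.
by have -> : delta^* = delta by apply/CrealP/ger0_real.
Qed.

Lemma shiftmx_psd : psdmx shiftmx.
Proof.
split; first by rewrite adjmxM adjmx_inv adj_shift psdN.1 shiftmx_comm.
move=> v; pose w := invmx B *m v.
have vE : v = B *m w by rewrite /w mulKVmx // shift_unit.
(* With [v = B w] the form becomes that of [N - delta N^2] at [w], which is nonnegative by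
   [psdmx_sqnorm_le]. *)
have -> : qform shiftmx v = qform N w - delta * (adjmx (N *m w) *m (N *m w)) 0 0.
  rewrite /qform vE (adjmxM B w) adj_shift /shiftmx -!mulmxA (mulKmx shift_unit).
  rewrite (_ : B *m (N *m w) = N *m w - delta *: (N *m (N *m w))).
    by rewrite mulmxBr mxE -scalemxAr [X in _ + X]mxE [X in - X]mxE
      (adjmxM N w) psdN.1 -mulmxA.
  by rewrite mulmxBl mul1mx -scalemxAl.
rewrite subr_ge0 (le_trans (ler_wpM2l delta0 (psdmx_sqnorm_le psdN w))) //.
by rewrite mulrA -[leRHS]mul1r ler_wpM2r ?psdN.2 // ltW.
Qed.

(* With [N = M^-1] and [shiftmx = (M - delta)^-1] this is the barrier estimate:
   averaging over the removed index decreases [\tr shiftmx] by at least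
   [\tr shiftmx^2 / \tr shiftmx], which pays for the shift. *)
Lemma shiftmx_tr :
  (\tr shiftmx - \tr N) * \tr shiftmx <= \tr (shiftmx *m shiftmx).
Proof.
set N' := shiftmx; have psdN' := shiftmx_psd.
(* The resolvent identity gives [\tr N' = \tr N + delta T] and [\tr N'^2 = T + delta Q], so the
   claim is [delta T (\tr N + delta T) <= T + delta Q]. *)
pose T := \tr (N *m N'); pose Q := \tr (adjmx N' *m N *m N').
have Q0 : 0 <= Q by exact: psdmx_tr_conj_ge0.
have NE : N' = N + delta *: (N *m N') by exact: shiftmxE.
have trN' : \tr N' = \tr N + delta * T by rewrite {1}NE mxtraceD mxtraceZ.
have trN'2 : \tr (N' *m N') = T + delta * Q.
  rewrite {1}NE mulmxDl mxtraceD -scalemxAl mxtraceZ /Q psdN'.1.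
  by rewrite [N' *m N]shiftmx_commN.
have T0 : 0 <= T.
  have -> : T = \tr (adjmx N *m 1%:M *m N) + delta * \tr (adjmx N *m N' *m N).
    rewrite /T {1}NE mulmxDr mxtraceD -scalemxAr mxtraceZ mulmx1 psdN.1.
    by rewrite -[_ *m N' *m N]mulmxA shiftmx_commN.
  rewrite addr_ge0 ?mulr_ge0 ?psdmx_tr_conj_ge0 //.
  split; first by rewrite adjmx_scalar rmorph1.
  by move=> v; rewrite /qform mulmx1 adjmx_mul_ge0.
have trN0 := psdmx_tr_ge0 psdN.
(* Cauchy-Schwarz for traces: the trace of [N] conjugated by [N' - t] is nonnegative, and
   [t = T / \tr N] minimizes it. *)
have TQ : T ^+ 2 <= Q * \tr N.
  have [tr0|trn0] := eqVneq (\tr N) 0.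
    by rewrite tr0 mulr0 /T [N in N *m _](psdmx_tr_eq0 psdN tr0) mul0mx mxtrace0 expr0n.
  have trgt0 : 0 < \tr N by rewrite lt_neqAle eq_sym trn0.
  pose t := T / \tr N.
  have tr : t^* = t by apply/CrealP/ger0_real; rewrite divr_ge0.
  have := psdmx_tr_conj_ge0 psdN (N' - t%:M).
  rewrite adjmxB adjmx_scalar tr psdN'.1 mulmxBl mul_scalar_mx !mulmxBr.
  rewrite !mul_mx_scalar !mulmxBl shiftmx_commN -!scalemxAl.
  rewrite !(mxtraceD, raddfN, raddfB) /= !mxtraceZ.
  have -> : \tr (N *m N' *m N') = Q by rewrite /Q psdN'.1 shiftmx_commN.
  rewrite -/N' -/T /t; set X := (X in 0 <= X).
  have -> : X = (Q * \tr N - T ^+ 2) / \tr N by rewrite /X; field.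
  by rewrite pmulr_lge0 ?invr_gt0 // subr_ge0.
(* Termwise: [delta T \tr N <= T], and [(delta T)^2 <= delta^2 Q \tr N <= delta Q]. *)
rewrite trN' trN'2 addrC addKr mulrDr lerD //.
  by rewrite mulrAC -[leRHS]mul1r ler_wpM2r // ltW.
rewrite -mulrA ler_wpM2l // mulrCA -expr2.
rewrite (le_trans (ler_wpM2l delta0 TQ)) // mulrCA.
by rewrite -[leRHS]mulr1 ler_wpM2l // ltW.
Qed.

End Shift.

(** * Deleting one index *)

Section Remove.
Variables (n : nat) (N : 'M[C]_n) (i : 'I_n).
Hypotheses (psdN : psdmx N) (Nii : 0 < N i i).

(** A Schur complement: if [N] inverts a matrix, this inverts the submatrix without row and column
    [i], extended by zero. *)
Definition removemx := N - (N i i)^-1 *: (col i N *m adjmx (col i N)).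

Lemma removemx_mul (v : 'cV[C]_n) :
  removemx *m v = N *m v - ((N i i)^-1 * (N *m v) i 0) *: col i N.
Proof.
rewrite mulmxBl -scalemxAl -mulmxA -scalerA; congr (_ - _ *: _).
rewrite [X in col i N *m X]mx11_scalar mul_mx_scalar; congr (_ *: _).
by rewrite colE adjmxM psdN.1 adj_delta_mul.
Qed.

Lemma removemx_psd : psdmx removemx.
Proof.
have rN : ((N i i)^-1)^* = (N i i)^-1.
  by apply/CrealP/ger0_real; rewrite invr_ge0 ltW.
split; first by rewrite adjmxB adjmxZ adjmxM adjmxK psdN.1 rN.
move=> v; rewrite /qform -mulmxA removemx_mul mulmxBr mulmxA mxE -/(qform N v).
rewrite -scalemxAr mxE [X in _ - X]mxE.
have -> : (adjmx v *m col i N) 0 0 = ((N *m v) i 0)^*.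
  by rewrite -adj_delta_mul -(psdmx_conj psdN) colE mulmxA.
rewrite subr_ge0 -mulrA mulrC ler_pdivrMr //.
by rewrite -normCK mulrC; exact: psdmx_entry_le.
Qed.

Lemma removemx_tr :
  \tr removemx = \tr N - (N *m N) i i / N i i.
Proof.
rewrite raddfB /= mxtraceZ mxtrace_mulC mulrC; congr (_ - _ * _).
rewrite trace_mx11 !mxE; apply: eq_bigr => j _; rewrite !mxE.
by rewrite -{3}psdN.1 adjmxE.
Qed.

(** Columns deleted earlier stay zero, which is how the support condition of [barrier] survives a
    deletion. *)
Lemma removemx_col a j : (j == i) || [forall b, N b j == 0] -> removemx a j = 0.
Proof.
have rc : adjmx (col i N) 0 j = N i j by rewrite -{2}psdN.1 adjmxE !mxE.
rewrite !mxE big_ord1 rc [col i N a 0]mxE => /orP[/eqP->|/forallP N0].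
  by rewrite mulrCA mulVf ?gt_eqF // mulr1 subrr.
by rewrite !(eqP (N0 _)) !mulr0 subrr.
Qed.

End Remove.

Lemma psdmx_diag_max n (N : 'M[C]_n) : psdmx N -> 0 < \tr N ->
  exists2 i, 0 < N i i & N i i * \tr (N *m N) <= (N *m N) i i * \tr N.
Proof.
move=> psdN tr0.
have NNE i : (N *m N) i i = 
    let e := delta_mx i 0 : 'cV[C]_n in (adjmx (N *m e) *m (N *m e)) 0 0.
  by rewrite /= adjmxM psdN.1 -mulmxA adjmx_delta -rowE mulmxA -colE !mxE.
have NN0 i : 0 <= (N *m N) i i by rewrite NNE /= adjmx_mul_ge0.
have trNN0 : 0 <= \tr (N *m N) by apply: sumr_ge0.
have d0 := psdmx_diag_ge0 psdN.
have [/existsP[i /andP[]]|/existsPn noi] :=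
  boolP [exists i, (0 < N i i) && (N i i * \tr (N *m N) <= (N *m N) i i * \tr N)].
  by exists i.
(* Without a good index the opposite inequality holds for every [i], strictly unless [N i i = 0],
   when [N e_i = 0] and both sides vanish. Both sides have the same sum over [i], so all diagonal
   entries would be zero, contradicting [0 < \tr N]. *)
have le i : (N *m N) i i * \tr N <= N i i * \tr (N *m N) ?= iff (N i i == 0).
  have := noi i; rewrite lt_neqAle eq_sym d0 andbT.
  have [N0|N0] /= := eqVneq (N i i) 0.
    move=> _; rewrite N0 mul0r NNE /=.
    have -> : N *m delta_mx i 0 = 0 :> 'cV[C]_n.
      apply: adjmx_mul_eq0; apply/le_anti; rewrite adjmx_mul_ge0 andbT.
      by rewrite (le_trans (psdmx_sqnorm_le psdN _)) // qform_delta N0 mulr0.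
    by rewrite mulmx0 mxE mul0r; apply/leifP.
  rewrite -real_ltNge ?ger0_real ?mulr_ge0 // ?(ltW tr0) // => lt.
  by apply/leifP.
have /leif_sum := fun i (_ : xpredT i) => le i.
rewrite -!mulr_suml -!/(\tr _) => /leifP.
rewrite [\tr N * _]mulrC ltxx; case: ifP => // /forallP all0 _.
have : \tr N = 0 by apply: big1 => i _; apply/eqP/(implyP (all0 i)).
by move=> trN; move: tr0; rewrite trN ltxx.
Qed.

(** * The barrier argument *)

Section RestrictedInvertibility.
Variables (m : nat) (P : 'M[C]_m) (beta delta : C).
Hypotheses (adjP : adjmx P = P) (PP : P *m P = P).
Hypotheses (beta0 : 0 < beta) (delta0 : 0 <= delta).

(** The trace of [(P + beta)^-1]: the projection [P] has eigenvalue 1 with multiplicity [\tr P] and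
    eigenvalue 0 otherwise. *)
Let Phi := \tr P / (1 + beta) + (m%:R - \tr P) / beta.

Hypothesis deltaPhi : delta * Phi < 1.

Definition supported (sigma : {set 'I_m}) (v : 'cV[C]_m) :=
  forall i, i \notin sigma -> v i 0 = 0.

(* [N] is the inverse of the compression of [P - b] to the coordinates in
   [sigma], extended by zero. *)
Record barrier (b : C) (sigma : {set 'I_m}) (N : 'M[C]_m) : Prop := Barrier {
  barrier_psd : psdmx N ;
  barrier_tr : \tr N <= Phi ;
  barrier_supp : forall i j, j \notin sigma -> N i j = 0 ;
  barrier_inv : forall v, supported sigma v -> N *m ((P - b%:M) *m v) = v }.

(** The inverse of [P + beta] is read off from the splitting into the ranges of [P] and [1 - P]. *)
Lemma barrier_init : exists N, barrier (- beta) finset.setT N.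
Proof.
have b1 : 0 < 1 + beta by rewrite addr_gt0.
have br : (beta^-1)^* = beta^-1.
  by apply/CrealP/ger0_real; rewrite invr_ge0 ltW.
have b1r : ((1 + beta)^-1)^* = (1 + beta)^-1.
  by apply/CrealP/ger0_real; rewrite invr_ge0 ltW.
have QQ : (1%:M - P) *m (1%:M - P) = 1%:M - P.
  by rewrite mulmxBl mul1mx mulmxBr mulmx1 PP subrr subr0.
exists ((1 + beta)^-1 *: P + beta^-1 *: (1%:M - P)); split.
- split.
    by rewrite adjmxD !adjmxZ adjmxB adjmx_scalar rmorph1 adjP b1r br.
  move=> v; rewrite /qform mulmxDr mulmxDl -!scalemxAr -!scalemxAl.
  set p := adjmx v *m P *m v; set q := adjmx v *m _ *m v.
  have -> : p = adjmx (P *m v) *m (P *m v).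
    by rewrite adjmxM adjP mulmxA -(mulmxA _ P P) PP.
  have -> : q = adjmx ((1%:M - P) *m v) *m ((1%:M - P) *m v).
    rewrite adjmxM adjmxB adjP adjmx_scalar rmorph1 mulmxA.
    by rewrite -(mulmxA _ (_ - _) (_ - _)) QQ.
  rewrite mxE addr_ge0 // mxE mulr_ge0 ?adjmx_mul_ge0 // invr_ge0 ltW //.
- by rewrite mxtraceD !mxtraceZ raddfB /= mxtrace1 mulrC [X in _ + X]mulrC.
- by move=> i j; rewrite inE.
move=> v _; rewrite mulmxA; set X := (X in X *m v).
suff -> : X = 1%:M by rewrite mul1mx.
have QP : (1%:M - P) *m P = 0 by rewrite mulmxBl mul1mx PP subrr.
rewrite /X raddfN /= opprK mulmxDl -!scalemxAl !mulmxDr PP QP add0r.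
rewrite !mul_mx_scalar [_ *: (_ *: (_ - _))]scalerA mulVf ?gt_eqF // scale1r.
rewrite -{1}[P]scale1r -scalerDl scalerA mulVf ?gt_eqF // scale1r.
by rewrite addrC subrK.
Qed.

Lemma barrier_step b sigma N : sigma != finset.set0 -> barrier b sigma N ->
  exists i N', i \in sigma /\ barrier (b + delta) (sigma :\ i) N'.
Proof.
move=> /set0Pn[s0 s0in] [psdN trN suppN invN].
have dtr : delta * \tr N < 1 by rewrite (le_lt_trans _ deltaPhi) // ler_wpM2l.
pose N' := shiftmx N delta.
have psdN' : psdmx N' := shiftmx_psd psdN delta0 dtr.
have suppN' i j : j \notin sigma -> N' i j = 0.
  move=> js; rewrite /N' /shiftmx -shiftmx_comm // mxE big1 // => k _.
  by rewrite suppN // mulr0.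
have invN' v : supported sigma v -> N' *m ((P - (b + delta)%:M) *m v) = v.
  move=> sv; rewrite /N' /shiftmx -shiftmx_comm // -mulmxA.
  rewrite raddfD /= opprD addrA mulmxBl mulmxBr invN // mul_scalar_mx.
  rewrite -scalemxAr scalemxAl -{1}[v]mul1mx -mulmxBl mulKmx //.
  exact: shift_unit.
(* [N'] is a left inverse on a nonempty set of coordinates, hence nonzero, and a positive
   semidefinite matrix of trace zero is zero. *)
have trN'0 : 0 < \tr N'.
  rewrite lt_neqAle psdmx_tr_ge0 // andbT eq_sym; apply/eqP => /(psdmx_tr_eq0 psdN') N0.
  have sv : supported sigma (delta_mx s0 0).
    move=> j js; rewrite mxE; case: eqP => // js0.
    by rewrite js0 s0in in js.
  have := invN' _ sv; rewrite N0 mul0mx => /matrixP /(_ s0 0).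
  by rewrite !mxE !eqxx => /eqP; rewrite eq_sym oner_eq0.
have [i Nii imax] := psdmx_diag_max psdN' trN'0.
have isig : i \in sigma.
  by apply: contraTT Nii => /suppN' ->; rewrite ltxx.
exists i, (removemx N' i); split => //; split.
- exact: removemx_psd.
(* The loss [(N'^2)_ii / N'_ii] is at least [\tr N'^2 / \tr N'] by the choice of [i], and this is at
   least the gain [\tr N' - \tr N] by [shiftmx_tr]. *)
- rewrite removemx_tr // (le_trans _ trN) // lerBlDr -lerBlDl.
  rewrite -(ler_pM2r trN'0) (le_trans (shiftmx_tr psdN delta0 dtr)) //.
  by rewrite mulrAC ler_pdivlMr // mulrC.
- move=> a j; rewrite !inE negb_and negbK => jn; apply: removemx_col => //.
  case/orP: jn => [->//|jn]; apply/orP; right.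
  by apply/forallP => c; rewrite suppN'.
move=> v sv; have sv' : supported sigma v.
  by move=> j js; apply: sv; rewrite !inE negb_and js orbT.
(* The rank-one correction is proportional to [v i 0], which is zero once [i] has left the
   support. *)
rewrite removemx_mul // invN' // sv ?mulr0 ?scale0r ?subr0 //.
by rewrite !inE eqxx.
Qed.

Theorem restricted_invertibility k : (k <= m)%N ->
  exists sigma : {set 'I_m}, #|sigma| = (m - k)%N /\
    forall v, supported sigma v ->
      (k%:R * delta - beta) * (adjmx v *m v) 0 0 <= qform P v.
Proof.
move=> km.
have [sigma [N [cs bN]]] : exists (sigma : {set 'I_m}) N, #|sigma| = (m - k)%N /\
    barrier (k%:R * delta - beta) sigma N.
  elim: k km => [_|k IH km].
    have [N bN] := barrier_init.
    by exists finset.setT, N; rewrite cardsT card_ord subn0 mul0r sub0r.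
  have [sigma [N [cs bN]]] := IH (ltnW km).
  have s0 : sigma != finset.set0 by rewrite -card_gt0 cs subn_gt0.
  have [i [N' [isig bN']]] := barrier_step s0 bN.
  exists (sigma :\ i), N'; split.
    by have := cardsD1 i sigma; rewrite isig cs subnS => ->.
  by move: bN'; rewrite -natr1 mulrDl mul1r addrAC.
exists sigma; split => // v sv.
have [psdN _ _ /(_ _ sv)] := bN.
set b := _ - beta; set Q := P - b%:M => vE.
have adjQ : adjmx Q = Q.
  rewrite adjmxB adjP adjmx_scalar; congr (_ - _%:M).
  apply/CrealP; rewrite rpredB // ?rpredM ?realn ?ger0_real //.
  exact: ltW.
(* Since [N Q v = v], the form of [N] at [Q v] equals the form of [Q = P - b] at [v]; nonnegativity
   of the first is the claim. *)
have := psdN.2 (Q *m v); rewrite /qform -mulmxA vE adjmxM adjQ.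
rewrite mulmxBr mulmxBl mxE mul_mx_scalar -scalemxAl [X in _ + X]mxE [X in _ - X]mxE.
by rewrite subr_ge0.
Qed.

End RestrictedInvertibility.
End Adjoint.

(** * Discrete Fourier matrices *)

Section Fourier.
Variable R : realType.
Local Notation CC := (R[i] : numClosedFieldType).

Definition cis (x : R) : R[i] := Complex (cos x) (sin x).

Lemma cisD x y : cis (x + y) = cis x * cis y.
Proof.
rewrite /cis cosD sinD; apply/eqP; rewrite eq_complex /= addrC eqxx /=.
by apply/eqP; ring.
Qed.

Lemma cis0 : cis 0 = 1.
Proof. by rewrite /cis cos0 sin0. Qed.

Lemma conj_cis x : (cis x)^* = cis (- x) :> R[i].
Proof. by rewrite /cis cosN sinN. Qed.

Lemma cisX x n : cis x ^+ n = cis (n%:R * x).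
Proof.
elim: n => [|n IH]; first by rewrite expr0 mul0r cis0.
by rewrite exprSr IH -cisD -natr1 mulrDl mul1r.
Qed.

Lemma cis_period (k : int) : cis (2 * pi * k%:~R) = 1.
Proof.
have nat_period n : cis (2 * pi * n%:R) = 1.
  rewrite mulrC -cisX; have -> : cis (2 * pi) = 1.
    by rewrite /cis mulr_natl cos2pi sin2pi.
  by rewrite expr1n.
case: k => n; first exact: nat_period.
rewrite NegzE rmorphN mulrN -[RHS](nat_period n.+1) -conj_cis nat_period.
exact: conjC1.
Qed.

Lemma cis_eq1 x : 0 < x < 2 * pi -> cis x != 1.
Proof.
move=> /andP[x0 x2]; rewrite eq_complex /= negb_and; apply/orP; left.
have s0 : 0 < sin (x / 2) by apply: sin_gt0_pi; apply/andP; split; lra.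
have -> : x = (x / 2) *+ 2 by rewrite mulr2n; field.
rewrite cos_mulr2n cos2sin2; apply/eqP => h.
have : sin (x / 2) ^+ 2 = 0.
  by move: h; rewrite mulr2n; set s := sin _ ^+ 2 => h; lra.
by apply/eqP; rewrite expf_neq0 // gt_eqF.
Qed.

(** A geometric sum whose ratio is an [m]-th root of unity different from 1. *)
Lemma cis_sum m (k : int) : (0 < `|k| < m)%N ->
  \sum_(a < m) cis (2 * pi * k%:~R * a%:R / m%:R) = 0.
Proof.
move=> /andP[k0 km]; have m0 : (m%:R : R) != 0 by rewrite pnatr_eq0; lia.
pose z := cis (2 * pi * k%:~R / m%:R).
have zE (a : nat) : cis (2 * pi * k%:~R * a%:R / m%:R) = z ^+ a.
  by rewrite cisX; congr cis; ring.
under eq_bigr do rewrite zE.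
have zm : z ^+ m = 1 by rewrite -zE mulfK // cis_period.
have z1 : z != 1.
  (* Conjugation exchanges [k] and [- k], and a positive [k] puts the angle in the range of
     [cis_eq1]. *)
  wlog kpos : k k0 km @z zE zm / (0 < k)%R.
    move=> wl; have [kp|kn] := ltP 0 k; first exact: (wl k k0 km _ _ kp).
    have kn' : 0 < - k by lia.
    have zN : z = (cis (2 * pi * (- k)%:~R / m%:R))^*.
      by rewrite conj_cis /z; congr cis; rewrite rmorphN; ring.
    rewrite zN -(inj_eq (can_inj conjCK)) conjCK conjC1.
    apply: (wl (- k)) => //; rewrite ?abszN //.
      by move=> a; rewrite cisX; congr cis; ring.
    by rewrite cisX mulrC mulfVK // cis_period.
  apply: cis_eq1; have mp : 0 < (m%:R : R) by rewrite ltr0n; lia.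
  have kp : 0 < (k%:~R : R) by rewrite ltr0z.
  have kmR : (k%:~R : R) < m%:R by rewrite -[m%:R]/(m%:Z%:~R) ltr_int; lia.
  have p0 := pi_gt0 R.
  rewrite divr_gt0 ?mulr_gt0 //= ltr_pdivrMr // ltr_pM2l //.
  by rewrite mulr_gt0.
have := subrX1 z m; rewrite zm subrr => /eqP; rewrite eq_sym mulf_eq0 subr_eq0.
by rewrite (negPf z1) => /eqP.
Qed.

Section DFT.
Variable m' : nat.
Local Notation m := m'.+1.

Definition dft : 'M[CC]_m :=
  \matrix_(s < m, a < m) cis (2 * pi * s%:R * a%:R / m%:R).

Lemma dft_adj : dft *m adjmx dft = (m%:R)%:M.
Proof.
apply/matrixP => s s'; rewrite !mxE.
have termE (a : 'I_m) : dft s a * adjmx dft a s' =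
    cis (2 * pi * ((s%:Z - s'%:Z)%:~R) * a%:R / m%:R).
  rewrite adjmxE !mxE [(cis _)^*]conj_cis -cisD; congr cis.
  by rewrite rmorphB /=; ring.
under eq_bigr do rewrite termE.
have [<-|ne] := eqVneq s s'.
  under eq_bigr do rewrite subrr mulr0 mul0r mul0r cis0.
  by rewrite sumr_const card_ord mulr1n.
rewrite cis_sum ?mulr0n //.
have : (s : nat) <> s' by move/val_inj/eqP; rewrite (negPf ne).
by have := ltn_ord s; have := ltn_ord s'; lia.
Qed.

Lemma adj_dft : adjmx dft *m dft = (m%:R)%:M.
Proof.
have m0 : (m%:R : CC) != 0 by rewrite pnatr_eq0.
have : (m%:R^-1 *: dft) *m adjmx dft = 1%:M.
  by rewrite -scalemxAl dft_adj scale_scalar_mx mulVf.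
move=> /mulmx1C; rewrite -scalemxAr => /(congr1 (fun M => m%:R *: M)).
by rewrite scalerA mulfV // scale1r scale_scalar_mx mulr1.
Qed.

Variable E : {set 'I_m}.

Definition indmx : 'M[CC]_m := \matrix_(s, s') ((s == s') && (s \in E))%:R.
Definition bandmx : 'M[CC]_m := m%:R^-1 *: (adjmx dft *m indmx *m dft).

Lemma indmx_mul p (v : 'M[CC]_(m, p)) s j :
  (indmx *m v) s j = (s \in E)%:R * v s j.
Proof.
rewrite mxE (bigD1 s) //= big1 ?addr0; first by rewrite mxE eqxx.
by move=> s' /negPf ne; rewrite mxE eq_sym ne mul0r.
Qed.

Lemma indmx_idem : indmx *m indmx = indmx.
Proof.
apply/matrixP => s s'; rewrite indmx_mul !mxE.
by case: (s \in E); rewrite ?mul1r // mul0r andbF.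
Qed.

Lemma adj_indmx : adjmx indmx = indmx.
Proof.
apply/matrixP => s s'; rewrite adjmxE !mxE conjC_nat eq_sym.
by case: eqP => // ->.
Qed.

Lemma adj_bandmx : adjmx bandmx = bandmx.
Proof.
by rewrite adjmxZ !adjmxM adjmxK adj_indmx mulmxA fmorphV rmorph_nat.
Qed.

Lemma bandmx_idem : bandmx *m bandmx = bandmx.
Proof.
have m0 : (m%:R : CC) != 0 by rewrite pnatr_eq0.
rewrite -scalemxAl -scalemxAr !mulmxA -(mulmxA _ dft) dft_adj mul_mx_scalar.
by rewrite -!scalemxAl -(mulmxA _ indmx indmx) indmx_idem [_^-1 *: (m%:R *: _)]scalerA
  mulVf // scale1r.
Qed.

Lemma tr_bandmx : \tr bandmx = #|E|%:R.
Proof.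
have m0 : (m%:R : CC) != 0 by rewrite pnatr_eq0.
rewrite mxtraceZ -mulmxA mxtrace_mulC -mulmxA dft_adj mul_mx_scalar mxtraceZ.
rewrite mulKf // /mxtrace -sum1_card natr_sum [RHS]big_mkcond /=.
by apply: eq_bigr => s _; rewrite mxE eqxx; case: (s \in E).
Qed.

Lemma qform_bandmx (v : 'cV[CC]_m) :
  qform bandmx v = m%:R^-1 * \sum_(s in E) `|(dft *m v) s 0| ^+ 2.
Proof.
rewrite /qform -scalemxAr -scalemxAl mxE; congr (_ * _).
rewrite !mulmxA -adjmxM -!mulmxA [LHS]mxE [RHS]big_mkcond /=.
apply: eq_bigr => s _; rewrite indmx_mul adjmxE normCK.
by case: (s \in E); [rewrite mul1r mulrC | rewrite mul0r mulr0].
Qed.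

Lemma sqnorm_dft (v : 'cV[CC]_m) :
  (adjmx v *m v) 0 0 = m%:R^-1 * \sum_(s < m) `|(dft *m v) s 0| ^+ 2.
Proof.
have m0 : (m%:R : CC) != 0 by rewrite pnatr_eq0.
have -> : \sum_(s < m) `|(dft *m v) s 0| ^+ 2 = (adjmx (dft *m v) *m (dft *m v)) 0 0.
  by rewrite [RHS]mxE; apply: eq_bigr => s _; rewrite adjmxE normCK mulrC.
rewrite adjmxM -mulmxA (mulmxA _ dft) adj_dft mul_scalar_mx -scalemxAr [X in _ * X]mxE.
by rewrite mulKf.
Qed.

Definition residue (k : int) : 'I_m := inord `|(k %% m)%Z|.

Lemma residueE k : (residue k : nat)%:Z = (k %% m)%Z.
Proof.
have m0 : (m : int) != 0 by [].
rewrite /residue inordK ?gez0_abs ?modz_ge0 //.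
by rewrite -ltz_nat gez0_abs ?modz_ge0 // ltz_pmod.
Qed.

(** On the grid of step [2 pi / m] a frequency is seen only modulo [m]. *)
Lemma cis_residue (s : nat) (k : int) :
  cis (2 * pi * s%:R * (residue k)%:R / m%:R) = cis (2 * pi * s%:R * k%:~R / m%:R).
Proof.
have m0 : (m%:R : R) != 0 by rewrite pnatr_eq0.
have kE : (k%:~R : R) = (k %/ m)%Z%:~R * m%:R + (residue k)%:R.
  rewrite -[m%:R]/(m%:Z%:~R) -[(residue k)%:R]/((residue k)%:Z%:~R) residueE.
  by rewrite -rmorphM -rmorphD /= -divz_eq.
have -> : 2 * pi * s%:R * k%:~R / m%:R =
    2 * pi * (s%:Z * (k %/ m)%Z)%:~R + 2 * pi * s%:R * (residue k)%:R / m%:R :> R.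
  by rewrite kE rmorphM /=; field.
by rewrite cisD cis_period mul1r.
Qed.

Lemma sumRe (I : Type) (r : seq I) (F : I -> R[i]) :
  complex.Re (\sum_(i <- r) F i) = \sum_(i <- r) complex.Re (F i).
Proof. by apply: (big_morph (@complex.Re R)) => // -[? ?] [? ?]. Qed.

Lemma sumIm (I : Type) (r : seq I) (F : I -> R[i]) :
  complex.Im (\sum_(i <- r) F i) = \sum_(i <- r) complex.Im (F i).
Proof. by apply: (big_morph (@complex.Im R)) => // -[? ?] [? ?]. Qed.

(** * Trigonometric polynomials sampled at translates *)

Section TrigPoly.
Variables (ar ai : int -> R) (N : nat).

Definition trigpoly (t : R) : R[i] :=
  \sum_(0 <= j < N.*2.+1) Complex (ar (j%:Z - N%:Z)) (ai (j%:Z - N%:Z))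
                          * cis ((j%:Z - N%:Z)%:~R * t).

Lemma partial_sum_sqnormE t :
  real_complex R (partial_sum_sqnorm ar ai N t) = `|trigpoly t| ^+ 2.
Proof.
rewrite -add_Re2_Im2 /trigpoly sumRe sumIm; by [].
Qed.

(** The terms of [trigpoly] grouped by frequency modulo [m]. A translation by [2 pi s / m]
    multiplies each group by one phase, so the Fourier matrix turns this vector into the samples of
    the polynomial. *)
Definition residue_vec (t : R) : 'cV[CC]_m :=
  \col_a \sum_(0 <= j < N.*2.+1 | residue (j%:Z - N%:Z) == a)
    Complex (ar (j%:Z - N%:Z)) (ai (j%:Z - N%:Z)) * cis ((j%:Z - N%:Z)%:~R * t).

Lemma dft_residue_vec t s :
  (dft *m residue_vec t) s 0 = trigpoly (t + 2 * pi * s%:R / m%:R).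
Proof.
rewrite mxE /trigpoly.
transitivity (\sum_(a < m) \sum_(0 <= j < N.*2.+1 | residue (j%:Z - N%:Z) == a)
    Complex (ar (j%:Z - N%:Z)) (ai (j%:Z - N%:Z))
      * cis ((j%:Z - N%:Z)%:~R * (t + 2 * pi * s%:R / m%:R))).
  apply: eq_bigr => a _; rewrite !mxE mulr_sumr; apply: eq_bigr => j /eqP <-.
  rewrite cis_residue mulrCA -cisD; congr (_ * cis _).
  by field; rewrite nat1r pnatr_eq0.
by rewrite [RHS](partition_big (fun j => residue (j%:Z - N%:Z)) xpredT).
Qed.

Lemma residue_vec_supp (sigma : {set 'I_m}) t :
  (forall k, residue k \notin sigma -> ar k = 0 /\ ai k = 0) ->
  supported sigma (residue_vec t).
Proof.
move=> a0 a an; rewrite mxE big1 // => j /eqP ja.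
by have [|-> ->] := a0 (j%:Z - N%:Z); [rewrite ja|rewrite mul0r].
Qed.

End TrigPoly.

(** [restricted_invertibility] for [bandmx], tested on [residue_vec]; the common factor [1 / m]
    cancels. The set [sigma] depends neither on the coefficients nor on [N] and [t], so the
    inequality can be integrated in [t]. *)
Lemma band_selection (beta delta : R) (k : nat) :
  0 < beta -> 0 <= delta ->
  delta * (#|E|%:R / (1 + beta) + (m%:R - #|E|%:R) / beta) < 1 -> (k <= m)%N ->
  exists sigma : {set 'I_m}, #|sigma| = (m - k)%N /\
    forall ar ai N t,
      (forall l, residue l \notin sigma -> ar l = 0 /\ ai l = 0) ->
      (k%:R * delta - beta) *
        \sum_(s < m) partial_sum_sqnorm ar ai N (t + 2 * pi * s%:R / m%:R)
      <= \sum_(s in E) partial_sum_sqnorm ar ai N (t + 2 * pi * s%:R / m%:R).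
Proof.
move=> beta0 delta0 dP km.
have [|||sigma [cs sH]] := @restricted_invertibility CC m bandmx
  (real_complex R beta) (real_complex R delta) adj_bandmx bandmx_idem _ _ _ k km.
- by rewrite -(rmorph0 (real_complex R)) ltcR.
- by rewrite -(rmorph0 (real_complex R)) lecR.
- rewrite tr_bandmx -[X in _ < X](rmorph1 (real_complex R)).
  move: dP; rewrite -ltcR; congr (_ < _).
  by rewrite rmorphM rmorphD !fmorph_div rmorphD rmorphB rmorph1 !rmorph_nat.
exists sigma; split => // ar ai N t a0.
have := sH _ (residue_vec_supp N t a0).
rewrite sqnorm_dft qform_bandmx mulrCA ler_pM2l ?invr_gt0 ?ltr0n //.
have termE s : `|(dft *m residue_vec ar ai N t) s 0| ^+ 2 =
    real_complex R (partial_sum_sqnorm ar ai N (t + 2 * pi * s%:R / m%:R)).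
  by rewrite dft_residue_vec -partial_sum_sqnormE.
rewrite (eq_bigr _ (fun s _ => termE s)).
rewrite [X in _ <= X -> _](eq_bigr _ (fun s _ => termE s)).
rewrite -!rmorph_sum -[k%:R](rmorph_nat (real_complex R)) -!(rmorphM, rmorphB) /=.
by rewrite lecR.
Qed.

End DFT.
End Fourier.

Local Open Scope classical_set_scope.
Local Open Scope ring_scope.

(** * Primitives and the Parseval identity *)

Section Parseval.
Variable R : realType.

Lemma is_derive_bigsum (I : Type) (r : seq I) (P : pred I)
    (f : I -> R -> R) (df : I -> R) (x : R) :
  (forall i, is_derive x 1 (f i) (df i)) ->
  is_derive x 1 (fun t => \sum_(i <- r | P i) f i t) (\sum_(i <- r | P i) df i).
Proof.
move=> fd; elim: r => [|i r IH].
  rewrite big_nil (_ : (fun _ => _) = cst 0); first exact: is_derive_cst.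
  by apply/funext => t; rewrite big_nil.
rewrite big_cons; case: ifP => Pi.
  rewrite (_ : (fun _ => _) = f i + (fun t => \sum_(i <- r | P i) f i t)).
    exact: is_deriveD.
  by apply/funext => t; rewrite big_cons Pi.
by rewrite (_ : (fun _ => _) = (fun t => \sum_(i <- r | P i) f i t)) //;
  apply/funext => t; rewrite big_cons Pi.
Qed.

Lemma is_derive_affine (f df : R -> R) (a b x : R) :
  (forall y : R, is_derive y 1 f (df y)) ->
  is_derive x 1 (fun t => f (a * t + b)) (df (a * x + b) * a).
Proof.
move=> fd; apply: (@is_derive1_comp R f (fun t => a * t + b)) => //.
have -> : (fun t => a * t + b) = a \*: (@id R) + cst b by [].
rewrite -[X in is_derive _ _ _ X](_ : a *: 1 + 0 = a); last first.
  by rewrite addr0 -[LHS]/(a * 1) mulr1.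
by apply: is_deriveD.
Qed.

Lemma is_derive_scale (f : R -> R) (a x df : R) :
  is_derive x 1 f df -> is_derive x 1 (fun t => a * f t) (a * df).
Proof. by move=> fd; exact: (is_deriveZ (f := f)). Qed.

Lemma is_derive_continuous (f df : R -> R) :
  (forall x : R, is_derive x 1 f (df x)) -> continuous f.
Proof.
move=> fd x; apply/differentiable_continuous/derivable1_diffP.
by have [] := fd x.
Qed.

Lemma nondecreasing_is_derive (f df : R -> R) a b : a <= b ->
  (forall x : R, is_derive x 1 f (df x)) -> (forall x : R, 0 <= df x) -> f a <= f b.
Proof.
rewrite le_eqVlt => /predU1P[->//|ab] fd df0.
have fc : {within `[a, b], continuous f}.
  by apply: continuous_subspaceT; exact: is_derive_continuous fd.
have [c _ fE] := MVT ab (fun x _ => fd x) fc.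
by rewrite -subr_ge0 fE mulr_ge0 // subr_ge0 ltW.
Qed.

(** Frequency 0 needs its own branch, and it is the only one whose primitive changes over a
    period. *)
Definition int_cos (n : int) (t : R) : R :=
  if n == 0 then t else sin (n%:~R * t) / n%:~R.
Definition int_sin (n : int) (t : R) : R :=
  if n == 0 then 0 else - cos (n%:~R * t) / n%:~R.

Lemma is_derive_sinZ (a x : R) :
  is_derive x 1 (fun t => sin (a * t)) (cos (a * x) * a).
Proof.
have := @is_derive_affine sin cos a 0 x (is_derive_sin (R := R)).
by under eq_fun do rewrite addr0; rewrite addr0.
Qed.

Lemma is_derive_cosZ (a x : R) :
  is_derive x 1 (fun t => cos (a * t)) (- sin (a * x) * a).
Proof.
have := @is_derive_affine cos (fun y => - sin y) a 0 x (is_derive_cos (R := R)).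
by under eq_fun do rewrite addr0; rewrite addr0.
Qed.

Lemma is_derive_int_cos n (x : R) : is_derive x 1 (int_cos n) (cos (n%:~R * x)).
Proof.
rewrite /int_cos; have [->|n0] := eqVneq n 0.
  by rewrite mul0r cos0; exact: is_derive_id.
have n0R : (n%:~R : R) != 0 by rewrite intr_eq0.
have := is_derive_scale (n%:~R^-1) (is_derive_sinZ n%:~R x).
rewrite mulrCA mulVf // mulr1.
by under eq_fun do rewrite mulrC.
Qed.

Lemma is_derive_int_sin n (x : R) : is_derive x 1 (int_sin n) (sin (n%:~R * x)).
Proof.
rewrite /int_sin; have [->|n0] := eqVneq n 0.
  by rewrite mul0r sin0; exact: is_derive_cst.
have n0R : (n%:~R : R) != 0 by rewrite intr_eq0.
have := is_derive_scale (- n%:~R^-1) (is_derive_cosZ n%:~R x).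
have -> : - n%:~R^-1 * (- sin (n%:~R * x) * n%:~R) = sin (n%:~R * x) by field.
by under eq_fun do rewrite mulNr -mulrN mulrC.
Qed.

Lemma int_cos_period n :
  int_cos n (2 * pi) - int_cos n 0 = if n == 0 then 2 * pi else 0.
Proof.
rewrite /int_cos; case: ifP => n0; first by rewrite subr0.
rewrite mulr0 sin0 mul0r subr0.
suff -> : sin (n%:~R * (2 * pi) : R) = 0 by rewrite mul0r.
have sin_period (k : nat) : sin (k%:R * (2 * pi) : R) = 0.
  elim: k => [|k IH]; first by rewrite mul0r sin0.
  rewrite -natr1 mulrDl mul1r (_ : 2 * pi = pi *+ 2) ?mulr_natl //.
  by rewrite sinD2pi; move: IH; rewrite !mulr_natl.
case: (n) => k; first exact: sin_period.
by rewrite NegzE rmorphN mulNr sinN sin_period oppr0.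
Qed.

Lemma int_sin_period n : int_sin n (2 * pi) = int_sin n 0.
Proof.
rewrite /int_sin; case: ifP => // n0; rewrite mulr0 cos0.
suff -> : cos (n%:~R * (2 * pi) : R) = 1 by [].
have cos_period (k : nat) : cos (k%:R * (2 * pi) : R) = 1.
  elim: k => [|k IH]; first by rewrite mul0r cos0.
  rewrite -natr1 mulrDl mul1r (_ : 2 * pi = pi *+ 2) ?mulr_natl //.
  by rewrite cosD2pi; move: IH; rewrite !mulr_natl.
case: (n) => k; first exact: cos_period.
by rewrite NegzE rmorphN mulNr cosN cos_period.
Qed.

Section Coefficients.
Variables (ar ai : int -> R) (N : nat).
Local Notation k j := (j%:Z - N%:Z).
Local Notation p := (partial_sum_sqnorm ar ai N).

(** [corr] and [skew] are the real and imaginary parts of the conjugate of the [j]-th coefficient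
    times the [l]-th one. *)
Let corr j l := ar (k j) * ar (k l) + ai (k j) * ai (k l).
Let skew j l := ar (k j) * ai (k l) - ai (k j) * ar (k l).

Lemma partial_sum_sqnorm_double_sum t :
  p t = \sum_(0 <= j < N.*2.+1) \sum_(0 <= l < N.*2.+1)
    (corr j l * cos ((k j - k l)%:~R * t) + skew j l * sin ((k j - k l)%:~R * t)).
Proof.
rewrite /partial_sum_sqnorm !expr2 !mulr_suml -big_split; apply: eq_bigr => j _ /=.
rewrite !mulr_sumr -big_split; apply: eq_bigr => l _ /=.
have -> : (k j - k l)%:~R * t = (k j)%:~R * t - (k l)%:~R * t.
  by rewrite -mulrBl -rmorphB.
by rewrite cosB sinB /corr /skew; ring.
Qed.

Definition primitive_sqnorm (t : R) : R :=
  \sum_(0 <= j < N.*2.+1) \sum_(0 <= l < N.*2.+1)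
    (corr j l * int_cos (k j - k l) t + skew j l * int_sin (k j - k l) t).
Local Notation G := primitive_sqnorm.

Lemma is_derive_primitive (x : R) : is_derive x 1 G (p x).
Proof.
rewrite partial_sum_sqnorm_double_sum; apply: is_derive_bigsum => j.
apply: is_derive_bigsum => l.
apply: (@is_deriveD _ _ _ (fun t => corr j l * int_cos _ t)
  (fun t => skew j l * int_sin _ t)); apply: is_derive_scale.
  exact: is_derive_int_cos.
exact: is_derive_int_sin.
Qed.

Lemma partial_sum_sqnorm_continuous : continuous p.
Proof.
have -> : p = fun t => \sum_(0 <= j < N.*2.+1) \sum_(0 <= l < N.*2.+1)
    (corr j l * cos ((k j - k l)%:~R * t) + skew j l * sin ((k j - k l)%:~R * t)).
  by apply/funext => t; exact: partial_sum_sqnorm_double_sum.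
apply: is_derive_continuous => x; apply: is_derive_bigsum => j.
apply: is_derive_bigsum => l.
Qed.

Definition coef_sqsum : R :=
  \sum_(0 <= j < N.*2.+1) (ar (k j) ^+ 2 + ai (k j) ^+ 2).

(** Parseval: off the diagonal the frequency [k j - k l] is nonzero and its primitives agree at 0
    and [2 pi]. *)
Lemma primitive_period : G (2 * pi) - G 0 = 2 * pi * coef_sqsum.
Proof.
rewrite /G /coef_sqsum mulr_sumr -sumrB; apply: eq_big_nat => j jN.
rewrite -sumrB (bigD1_seq j) ?iota_uniq ?mem_index_iota //=.
rewrite big1 ?addr0 => [|l lj].
  have := int_cos_period (k j - k j); rewrite subrr eqxx.
  rewrite int_sin_period => h.
  transitivity (corr j j * (int_cos 0 (2 * pi) - int_cos 0 0)); first by ring.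
  by rewrite h /corr; ring.
have := int_cos_period (k j - k l); rewrite ifF; last by apply/eqP; lia.
rewrite int_sin_period => /eqP; rewrite subr_eq0 => /eqP ->; ring.
Qed.

Lemma partial_sum_sqnorm_ge0 t : 0 <= p t.
Proof. by rewrite addr_ge0 ?sqr_ge0. Qed.

(* The band inequality integrates over [0, h] without any change of variables:
   the derivative of the difference of the two sides is nonnegative. *)
Lemma band_primitive (m' : nat) (E : {set 'I_m'.+1}) (c : R) :
  let h := 2 * pi / m'.+1%:R in
  (forall t, c * \sum_(s < m'.+1) p (t + 2 * pi * s%:R / m'.+1%:R)
     <= \sum_(s in E) p (t + 2 * pi * s%:R / m'.+1%:R)) ->
  c * (2 * pi * coef_sqsum) <= \sum_(s in E) (G (h * s.+1%:R) - G (h * s%:R)).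
Proof.
move=> h band.
have h0 : 0 <= h by rewrite divr_ge0 // mulr_ge0 // pi_ge0.
pose H1 (t : R) := \sum_(s in E) G (1 * t + h * s%:R).
pose H2 (t : R) := (- c) * \sum_(s < m'.+1) G (1 * t + h * s%:R).
pose dH t := \sum_(s in E) p (1 * t + h * s%:R) * 1
            + (- c) * \sum_(s < m'.+1) p (1 * t + h * s%:R) * 1.
have Hd (t : R) : is_derive t 1 (H1 + H2) (dH t).
  rewrite /dH; apply: is_deriveD.
    apply: is_derive_bigsum => s; apply: is_derive_affine.
    exact: is_derive_primitive.
  apply: is_derive_scale; apply: is_derive_bigsum => s; apply: is_derive_affine.
  exact: is_derive_primitive.
have dH0 t : 0 <= dH t.
  rewrite /dH mulNr subr_ge0.
  have termE (s : nat) : p (1 * t + h * s%:R) * 1 = p (t + 2 * pi * s%:R / m'.+1%:R).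
    by rewrite mulr1 mul1r /h mulrAC.
  rewrite (eq_bigr _ (fun (s : 'I_m'.+1) _ => termE s)).
  by rewrite [leRHS](eq_bigr _ (fun (s : 'I_m'.+1) _ => termE s)).
have : H1 0 + H2 0 <= H1 h + H2 h := nondecreasing_is_derive h0 Hd dH0.
rewrite -subr_ge0 /H1 /H2 -primitive_period.
(* The [m] translates of [[0, h]] tile one full period. *)
have tele : \sum_(s < m'.+1) (G (h * s.+1%:R) - G (h * s%:R)) = G (2 * pi) - G 0.
  rewrite -(big_mkord xpredT (fun s => G (h * s.+1%:R) - G (h * s%:R))).
  rewrite telescope_sumr // mulr0 /h -mulrA mulVf ?mulr1 //.
have e0 (s : 'I_m'.+1) : 1 * 0 + h * s%:R = h * s%:R by rewrite mulr0 add0r.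
have eh (s : 'I_m'.+1) : 1 * h + h * s%:R = h * s.+1%:R.
  by rewrite mul1r -[s.+1%:R]natr1 mulrDr mulr1 addrC.
under eq_bigr do rewrite eh.
under [X in _ + _ * X - _]eq_bigr do rewrite eh.
under [X in _ - (X + _)]eq_bigr do rewrite e0.
under [X in _ - (_ + _ * X)]eq_bigr do rewrite e0.
rewrite -tele !sumrB => ineq; rewrite -subr_ge0; move: ineq; congr (_ <= _).
ring.
Qed.

End Coefficients.
End Parseval.

(** * Inner approximation of an open set by cells *)

Section Cells.
Variable R : realType.
Local Notation mu := (@lebesgue_measure R).

(** Half-open, so that distinct cells are disjoint. *)
Definition cell (h : R) (s : nat) : set R := `[h * s%:R, h * s.+1%:R[.

Lemma measurable_cell h s : measurable (cell h s).
Proof. exact: measurable_itv. Qed.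

Lemma cell_trivIset h (A : set nat) : 0 < h -> trivIset A (cell h).
Proof.
move=> h0 i j _ _ [t []]; rewrite /cell /= !in_itv /= => /andP[i1 i2] /andP[j1 j2].
have := le_lt_trans i1 j2; have := le_lt_trans j1 i2.
by rewrite !ltr_pM2l // !ltr_nat !ltnS => ? ?; apply/eqP; rewrite eqn_leq; apply/andP.
Qed.

Section Primitive.
Variables (p G : R -> R).
Hypotheses (p0 : forall t, 0 <= p t) (pc : continuous p).
Hypothesis Gp : forall x : R, is_derive x 1 G (p x).

Lemma measurable_fun_EFin_continuous (A : set R) :
  measurable A -> measurable_fun A (fun t => (p t)%:E).
Proof.
move=> mA; apply/measurable_EFinP; apply: (@measurable_funS _ _ _ _ setT) => //.
exact: continuous_measurable_fun.
Qed.

Lemma integral_primitive a b : a < b ->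
  (\int[mu]_(t in `[a, b]) (p t)%:E = (G b - G a)%:E)%E.
Proof.
move=> ab; have Gc := is_derive_continuous Gp.
rewrite (@continuous_FTC2 R p G a b) //.
- exact: continuous_subspaceT.
- split.
  + by move=> x _; have [] := Gp x.
  + by apply: cvg_at_right_filter; exact: Gc.
  + by apply: cvg_at_left_filter; exact: Gc.
- by move=> x _; rewrite derive1E; have [_ ->] := Gp x.
Qed.

Lemma integral_cells_le (m : nat) (E : {set 'I_m}) (h : R) (Omega : set R) :
  0 < h -> measurable Omega -> (forall s, s \in E -> cell h s `<=` Omega) ->
  ((\sum_(s in E) (G (h * s.+1%:R) - G (h * s%:R)))%:E
    <= \int[mu]_(t in Omega) (p t)%:E)%E.
Proof.
move=> h0 mO EO.
have mU : measurable (\big[setU/set0]_(s <- enum E) cell h s).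
  by apply: bigsetU_measurable => s _; exact: measurable_cell.
apply: (@le_trans _ _
  (\int[mu]_(t in \big[setU/set0]_(s <- enum E) cell h s) (p t)%:E)%E); last first.
  apply: ge0_subset_integral => //.
  - exact: measurable_fun_EFin_continuous.
  - by move=> t _; rewrite lee_fin.
  - rewrite -bigcup_seq => t [s /=]; rewrite mem_enum => sE; exact: EO.
rewrite ge0_integral_bigsetU //=.
- rewrite big_enum -sumEFin lee_sum // => s _.
  rewrite integral_itv_bndo_bndc ?integral_primitive ?ltr_pM2l ?ltr_nat //.
  by apply: measurable_fun_EFin_continuous; exact: measurable_itv.
- by move=> s; exact: measurable_cell.
- exact: enum_uniq.
- apply/trivIsetP => i j _ _ ij; apply/eqP/negP => /negP/set0P[t [ti tj]].
  have := cell_trivIset (A := setT) h0 I I (ex_intro _ t (conj ti tj)).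
  by move/val_inj/eqP; rewrite (negPf ij).
- exact: measurable_fun_EFin_continuous.
- by move=> t _; rewrite lee_fin.
Qed.

Lemma integral_le_period (Omega : set R) :
  measurable Omega -> Omega `<=` `[0, 2 * pi] ->
  (\int[mu]_(t in Omega) (p t)%:E <= (G (2 * pi) - G 0)%:E)%E.
Proof.
move=> mO sO; rewrite -integral_primitive; last by rewrite mulr_gt0 // pi_gt0.
apply: ge0_subset_integral => //.
- by apply: measurable_fun_EFin_continuous; exact: measurable_itv.
- by move=> t _; rewrite lee_fin.
Qed.

End Primitive.

(** * Erosions of an open set *)

Section Inner.
Variables (Omega : set R) (b : R).
Hypotheses (b0 : 0 < b) (oO : open Omega) (sO : Omega `<=` `[0, b]).

(** The points at distance at least [1 / (j + 1)] from the complement. Removing a union of open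
    balls leaves a closed set, which settles measurability. *)
Definition erosion (j : nat) : set R :=
  ~` \bigcup_(x in ~` Omega) ball x j.+1%:R^-1.

Lemma erosion_ball j t : erosion j t -> ball t j.+1%:R^-1 `<=` Omega.
Proof.
move=> tA x tx; apply: contrapT => xO; apply: tA; exists x => //.
exact: ball_sym.
Qed.

Lemma bigcup_erosion : \bigcup_j erosion j = Omega.
Proof.
apply/seteqP; split => [t [j _ /erosion_ball tO]|t tO].
  by apply: tO; exact: ballxx.
have [e /= e0 eO] : nbhs_ball t Omega.
  by apply/nbhs_ballP; move: oO; rewrite openE => /(_ _ tO).
have [j je] : exists j, j.+1%:R^-1 < e.
  exists (Num.truncn e^-1); rewrite invf_plt ?posrE //.
  have e0' : 0 <= e^-1 by rewrite invr_ge0 ltW.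
  by have /andP[] := truncn_itv e0'.
exists j => // -[x /= xO xt]; apply: xO; apply: eO.
by apply: ball_sym; apply: le_ball xt; exact: ltW.
Qed.

Lemma measurable_erosion j : measurable (erosion j).
Proof.
apply: measurableC; apply: open_measurable; apply: bigcup_open => x _.
exact: ball_open.
Qed.

(** Openness excludes the endpoint [b], which lies in none of the [m] half-open cells. *)
Lemma open_lt_sup t : Omega t -> t < b.
Proof.
move=> tO; have [e /= e0 eO] : nbhs_ball t Omega.
  by apply/nbhs_ballP; move: oO; rewrite openE => /(_ _ tO).
have : Omega (t + e / 2).
  apply: eO; rewrite /ball /= opprD addrA subrr sub0r normrN gtr0_norm; lra.
by move=> /sO /=; rewrite in_itv /= => /andP[_]; lra.
Qed.

Lemma measure_open_le : (mu Omega <= b%:E)%E.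
Proof.
have mO := open_measurable oO.
apply: (@le_trans _ _ (mu `[0, b])).
  by apply: le_measure; rewrite ?inE //; exact: measurable_itv.
by rewrite lebesgue_measure_itv /= lte_fin b0 oppr0 adde0.
Qed.

Lemma measure_open_fin : mu Omega \is a fin_num.
Proof.
by rewrite ge0_fin_numE // (le_lt_trans measure_open_le) // ltry.
Qed.

(** A cell shorter than [1 / (j + 1)] that meets the erosion lies inside [Omega], so the cells
    contained in [Omega] cover the erosion. *)
Lemma erosion_le_cells j m : (0 < m)%N -> b / m%:R < j.+1%:R^-1 ->
  exists E : {set 'I_m}, (forall s, s \in E -> cell (b / m%:R) s `<=` Omega) /\
    (mu (erosion j) <= (b / m%:R * #|E|%:R)%:E)%E.
Proof.
move=> m0 hj; set h := b / m%:R.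
have h0 : 0 < h by rewrite divr_gt0 // ltr0n.
pose E := finset (fun s : 'I_m => `[< cell h s `<=` Omega >]).
exists E; split => [s|]; first by rewrite inE => /asboolP.
(* Rejected cells become empty, so subadditivity can run over all [m] indices. *)
pose F s := if `[< cell h s `<=` Omega >] then cell h s else set0.
have FE : (\sum_(s < m) mu (F s) = (h * #|E|%:R)%:E)%E.
  transitivity (\sum_(s < m) (if s \in E then h%:E else 0))%E.
    apply: eq_bigr => s _; rewrite inE /F; case: asboolP => _; last first.
      by rewrite measure0.
    rewrite lebesgue_measure_itv /= lte_fin ltr_pM2l // ltr_nat ltnSn.
    by rewrite -EFinB -mulrBr -natrB // subSnn mulr1.
  by rewrite -big_mkcond sumEFin sumr_const mulr_natr.
rewrite -FE; apply: content_subadditive.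
- move=> s _; rewrite /F; case: asboolP => // _; exact: measurable_cell.
- exact: measurable_erosion.
move=> t tA; rewrite -bigcup_mkord.
have tO : Omega t by apply: erosion_ball tA _ _; exact: ballxx.
have t0 : 0 <= t by have /= := sO tO; rewrite in_itv /= => /andP[].
have th0 : 0 <= t / h by rewrite divr_ge0 // ltW.
have /andP[s1 s2] := truncn_itv th0.
move: s1 s2; set s := Num.truncn _ => s1 s2.
have ts : cell h s t.
  rewrite /cell /= in_itv /= mulrC -ler_pdivlMr // s1 /=.
  by rewrite mulrC -ltr_pdivrMr.
exists s => /=.
  rewrite -(ltr_nat R) (le_lt_trans s1) // /h invf_div mulrA ltr_pdivrMr //.
  by rewrite mulrC ltr_pM2l ?ltr0n // open_lt_sup.
rewrite /F; case: asboolP => // -[] x xs; apply: (erosion_ball tA).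
apply: (@le_ball _ _ _ h); first exact: ltW.
move: ts xs; rewrite /cell /= !in_itv /= -natr1 mulrDr mulr1.
move=> /andP[t1 t2] /andP[x1 x2]; rewrite /ball /= ltr_norml; lra.
Qed.

(** The erosions increase to [Omega], so by continuity from below one of them has almost full
    measure. All large [m] are allowed because the rounding of the density also asks for a large
    [m]. *)
Lemma inner_cells (eta : R) : 0 < eta ->
  exists m0 : nat, forall m, (m0 <= m)%N -> (0 < m)%N ->
  exists E : {set 'I_m}, (forall s, s \in E -> cell (b / m%:R) s `<=` Omega) /\
    fine (mu Omega) - eta <= b / m%:R * #|E|%:R.
Proof.
move=> eta0.
have cv : mu (erosion j) @[j --> \oo] --> mu Omega.
  rewrite -bigcup_erosion; apply: nondecreasing_cvg_mu.
  - exact: measurable_erosion.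
  - by rewrite bigcup_erosion; exact: open_measurable.
  - move=> i j ij; apply/subsetPset => t tA [x xO xt]; apply: tA; exists x => //.
    by apply: le_ball xt; rewrite lef_pV2 ?posrE ?ltr0n // ler_nat.
have muE : mu Omega = (fine (mu Omega))%:E by rewrite fineK // measure_open_fin.
have : mu (erosion j) @[j --> \oo] --> (fine (mu Omega))%:E by rewrite -muE.
move=> /fine_cvgP[fn /cvgrPdist_le /(_ _ eta0) near_eta].
have [j [jfin jeta]] : exists j, mu (erosion j) \is a fin_num /\
    `|fine (mu Omega) - fine (mu (erosion j))| <= eta.
  have [j _ jn] := filterI fn near_eta.
  by exists j; exact: (jn _ (leqnn j)).
exists (Num.truncn (b * j.+1%:R)).+1 => m mj m0.
have [|E [EO muE']] := @erosion_le_cells j m m0.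
  have mp : 0 < (m%:R : R) by rewrite ltr0n.
  rewrite ltr_pdivrMr // mulrC ltr_pdivlMr ?ltr0n //.
  have /andP[_ h] := truncn_itv (mulr_ge0 (ltW b0) (ler0n R j.+1)).
  by rewrite (lt_le_trans h) // ler_nat.
exists E; split => //.
have : fine (mu (erosion j)) <= b / m%:R * #|E|%:R by rewrite -lee_fin fineK.
by move: jeta; rewrite ler_norml => /andP[_]; lra.
Qed.

End Inner.
End Cells.

(** * Partial sums on Omega *)

Section PartialSums.
Variable R : realType.
Implicit Types ar ai br bi : int -> R.

Lemma sym_sum_rec (F : int -> R) N :
  \sum_(0 <= j < N.+1.*2.+1) F (j%:Z - N.+1%:Z) =
  F (- N.+1%:Z) + \sum_(0 <= j < N.*2.+1) F (j%:Z - N%:Z) + F N.+1%:Z.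
Proof.
rewrite doubleS big_nat_recl // big_nat_recr //= addrA sub0r.
congr (_ + _ + F _); last by lia.
by apply: eq_bigr => j _; congr F; lia.
Qed.

Lemma sym_sum_support (F : int -> R) M N : (M <= N)%N ->
  (forall k, (M < `|k|)%N -> F k = 0) ->
  \sum_(0 <= j < N.*2.+1) F (j%:Z - N%:Z) =
  \sum_(0 <= j < M.*2.+1) F (j%:Z - M%:Z).
Proof.
move=> MN F0; elim: N MN => [|N IH]; first by rewrite leqn0 => /eqP ->.
rewrite leq_eqVlt => /predU1P[->//|]; rewrite ltnS => MN.
by rewrite sym_sum_rec IH // !F0 ?add0r ?addr0 //; lia.
Qed.

(** Makes a partial sum of order [M] into one of any order [N >= M], so that two partial sums can be
    compared at the same order. *)
Definition trunc_coef (M : nat) (a : int -> R) (k : int) : R :=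
  if (`|k| <= M)%N then a k else 0.

Lemma sym_sum_trunc (F : int -> R -> R -> R) ar ai M N : (M <= N)%N ->
  (forall k, F k 0 0 = 0) ->
  \sum_(0 <= j < N.*2.+1) F (j%:Z - N%:Z) (trunc_coef M ar (j%:Z - N%:Z))
                            (trunc_coef M ai (j%:Z - N%:Z)) =
  \sum_(0 <= j < M.*2.+1) F (j%:Z - M%:Z) (ar (j%:Z - M%:Z)) (ai (j%:Z - M%:Z)).
Proof.
move=> MN F0.
rewrite (@sym_sum_support (fun k => F k (trunc_coef M ar k) (trunc_coef M ai k)) M N) //.
  apply: eq_big_nat => j jM.
  have jM' : (`|j%:Z - M%:Z| <= M)%N by lia.
  by rewrite /trunc_coef jM'.
by move=> k kM; rewrite /trunc_coef leqNgt kM /= F0.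
Qed.

Lemma partial_sum_sqnorm_trunc ar ai M N t : (M <= N)%N ->
  partial_sum_sqnorm (trunc_coef M ar) (trunc_coef M ai) N t =
  partial_sum_sqnorm ar ai M t.
Proof.
move=> MN; rewrite /partial_sum_sqnorm.
rewrite (@sym_sum_trunc (fun k x y => x * cos (k%:~R * t) - y * sin (k%:~R * t))) //.
  rewrite (@sym_sum_trunc (fun k x y => x * sin (k%:~R * t) + y * cos (k%:~R * t))) //.
  by move=> k; rewrite !mul0r addr0.
by move=> k; rewrite !mul0r subr0.
Qed.

Lemma coef_sqsum_trunc ar ai M N : (M <= N)%N ->
  coef_sqsum (trunc_coef M ar) (trunc_coef M ai) N = coef_sqsum ar ai M.
Proof.
move=> MN; apply: (@sym_sum_trunc (fun k x y => x ^+ 2 + y ^+ 2)) => // k.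
by rewrite expr0n addr0.
Qed.

Lemma coef_sqsum_tail ar ai M N : (M <= N)%N ->
  coef_sqsum (ar - trunc_coef M ar) (ai - trunc_coef M ai) N =
  coef_sqsum ar ai N - coef_sqsum ar ai M.
Proof.
move=> MN; rewrite -(coef_sqsum_trunc ar ai MN) -sumrB; apply: eq_bigr => j _.
have sub_fctE (f g : int -> R) x : (f - g) x = f x - g x by [].
rewrite !sub_fctE /trunc_coef; case: ifP => _; ring.
Qed.

Lemma coef_sqsum_nondecreasing ar ai : nondecreasing_seq (coef_sqsum ar ai).
Proof.
move=> M N MN; rewrite -subr_ge0 -coef_sqsum_tail //.
by apply: sumr_ge0 => j _; rewrite addr_ge0 ?sqr_ge0.
Qed.

(** Young's inequality with a weight: for real numbers the gap is the square
    [(eta w - (z - w))^2 / eta]. It takes the place of the triangle inequality and works directly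
    with squared norms. *)
Lemma partial_sum_sqnorm_sub ar ai br bi N t (eta : R) : 0 < eta ->
  partial_sum_sqnorm ar ai N t <= (1 + eta) * partial_sum_sqnorm br bi N t
    + (1 + eta^-1) * partial_sum_sqnorm (ar - br) (ai - bi) N t.
Proof.
move=> eta0.
have young (z w : R) : z ^+ 2 <= (1 + eta) * w ^+ 2 + (1 + eta^-1) * (z - w) ^+ 2.
  rewrite -subr_ge0.
  have -> : (1 + eta) * w ^+ 2 + (1 + eta^-1) * (z - w) ^+ 2 - z ^+ 2 =
      (eta * w - (z - w)) ^+ 2 / eta by field; rewrite gt_eqF.
  by rewrite divr_ge0 ?sqr_ge0 // ltW.
rewrite /partial_sum_sqnorm.
set z1 := \sum_(_ <= _ < _) _; set z2 := \sum_(_ <= _ < _) _.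
set w1 := \sum_(_ <= _ < _) _; set w2 := \sum_(_ <= _ < _) _.
set d1 := \sum_(_ <= _ < _) _; set d2 := \sum_(_ <= _ < _) _.
have sub_fctE (f g : int -> R) x : (f - g) x = f x - g x by [].
have -> : d1 = z1 - w1.
  by rewrite -sumrB; apply: eq_bigr => j _; rewrite !sub_fctE; ring.
have -> : d2 = z2 - w2.
  by rewrite -sumrB; apply: eq_bigr => j _; rewrite !sub_fctE; ring.
by rewrite !mulrDr addrACA lerD.
Qed.

(** * Squared norms on [Omega] and their convergence *)

Section OnOmega.
Variable Omega : set R.
Hypotheses (oO : open Omega) (sO : Omega `<=` `[0, 2 * pi]).
Local Notation mu := (@lebesgue_measure R).

Let mO : measurable Omega := open_measurable oO.
Let pi2 : 0 < 2 * pi :> R.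
Proof. by rewrite mulr_gt0 // pi_gt0. Qed.

Lemma integral_sqnorm_fin ar ai N :
  (\int[mu]_(t in Omega) (partial_sum_sqnorm ar ai N t)%:E)%E \is a fin_num.
Proof.
rewrite ge0_fin_numE; last first.
  by apply: integral_ge0 => t _; rewrite lee_fin partial_sum_sqnorm_ge0.
rewrite (le_lt_trans (integral_le_period (partial_sum_sqnorm_ge0 ar ai N)
  (@partial_sum_sqnorm_continuous _ ar ai N) (is_derive_primitive ar ai N) mO sO)) //.
exact: ltry.
Qed.

Lemma partial_L2sqE ar ai N : ((2 * pi * partial_L2sq Omega ar ai N)%:E =
  \int[mu]_(t in Omega) (partial_sum_sqnorm ar ai N t)%:E)%E.
Proof.
by rewrite /partial_L2sq mulrC divfK ?gt_eqF // fineK // integral_sqnorm_fin.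
Qed.

Lemma partial_L2sq_le ar ai N : partial_L2sq Omega ar ai N <= coef_sqsum ar ai N.
Proof.
rewrite -(ler_pM2l pi2) -primitive_period -lee_fin partial_L2sqE.
apply: integral_le_period => //.
- exact: partial_sum_sqnorm_ge0.
- exact: partial_sum_sqnorm_continuous.
- exact: is_derive_primitive.
Qed.

Lemma partial_L2sq_ge m' (E : {set 'I_m'.+1}) (c : R) ar ai N :
  (forall s, s \in E -> cell (2 * pi / m'.+1%:R) s `<=` Omega) ->
  (forall t, c * \sum_(s < m'.+1)
       partial_sum_sqnorm ar ai N (t + 2 * pi * s%:R / m'.+1%:R)
     <= \sum_(s in E) partial_sum_sqnorm ar ai N (t + 2 * pi * s%:R / m'.+1%:R)) ->
  c * coef_sqsum ar ai N <= partial_L2sq Omega ar ai N.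
Proof.
move=> EO band; rewrite -(ler_pM2l pi2) mulrCA.
rewrite (le_trans (band_primitive band)) // -lee_fin partial_L2sqE.
apply: integral_cells_le => //.
- exact: partial_sum_sqnorm_ge0.
- exact: partial_sum_sqnorm_continuous.
- exact: is_derive_primitive.
- by rewrite divr_gt0.
Qed.

Lemma partial_L2sq_sub ar ai br bi N (eta : R) : 0 < eta ->
  partial_L2sq Omega ar ai N <= (1 + eta) * partial_L2sq Omega br bi N
    + (1 + eta^-1) * partial_L2sq Omega (ar - br) (ai - bi) N.
Proof.
move=> eta0; rewrite -(ler_pM2l pi2).
set q := partial_L2sq Omega br bi N; set q' := partial_L2sq Omega (ar - br) _ N.
have -> : 2 * pi * ((1 + eta) * q + (1 + eta^-1) * q') =
    (1 + eta) * (2 * pi * q) + (1 + eta^-1) * (2 * pi * q') by ring.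
have e1 : 0 <= 1 + eta by rewrite addr_ge0 // ltW.
have e2 : 0 <= 1 + eta^-1 by rewrite addr_ge0 // invr_ge0 ltW.
have mp a b : measurable_fun Omega (fun t => (partial_sum_sqnorm a b N t)%:E).
  apply: measurable_fun_EFin_continuous => //.
  exact: partial_sum_sqnorm_continuous.
have p0 a b t : Omega t -> (0 <= (partial_sum_sqnorm a b N t)%:E)%E.
  by rewrite lee_fin partial_sum_sqnorm_ge0.
rewrite -lee_fin EFinD (EFinM (1 + eta)) (EFinM (1 + eta^-1)) /q /q' !partial_L2sqE.
rewrite -!ge0_integralZl //; try exact: mp; try exact: p0.
rewrite -ge0_integralD //.
- apply: ge0_le_integral => //.
  + exact: p0.
  + exact: mp.
  + apply: emeasurable_funD; apply: measurable_funeM; exact: mp.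
  + by move=> t _; rewrite -!EFinM -EFinD lee_fin partial_sum_sqnorm_sub.
- by move=> t Ot; rewrite mule_ge0 // p0.
- by apply: measurable_funeM; exact: mp.
- by move=> t Ot; rewrite mule_ge0 // p0.
- by apply: measurable_funeM; exact: mp.
Qed.

(** [partial_L2sq_sub] is applied in both directions between the sequence and its truncation, and
    the difference is bounded through [coef_sqsum_tail]. *)
Lemma partial_L2sq_dist ar ai M N (eta A : R) : 0 < eta -> (M <= N)%N ->
  coef_sqsum ar ai N <= A ->
  `|partial_L2sq Omega ar ai M - partial_L2sq Omega ar ai N| <=
    eta * A + (1 + eta^-1) * (A - coef_sqsum ar ai M).
Proof.
move=> eta0 MN AN.
have e2 : 0 <= 1 + eta^-1 by rewrite addr_ge0 // invr_ge0 ltW.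
set tr := trunc_coef M ar; set ti := trunc_coef M ai.
have qM : partial_L2sq Omega tr ti N = partial_L2sq Omega ar ai M.
  rewrite /partial_L2sq; congr (fine _ / _); apply: eq_integral => t _.
  by rewrite partial_sum_sqnorm_trunc.
have AM : coef_sqsum ar ai M <= A.
  exact: le_trans (coef_sqsum_nondecreasing ar ai MN) AN.
have tail : coef_sqsum ar ai N - coef_sqsum ar ai M <= A - coef_sqsum ar ai M.
  by rewrite lerD2r.
have d1 := partial_L2sq_le (ar - tr) (ai - ti) N.
rewrite coef_sqsum_tail // in d1.
have d2 : partial_L2sq Omega (tr - ar) (ti - ai) N <= A - coef_sqsum ar ai M.
  apply: le_trans (partial_L2sq_le _ _ N) _; apply: le_trans tail.
  rewrite -coef_sqsum_tail // le_eqVlt; apply/orP; left; apply/eqP.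
  have sub_fctE (f g : int -> R) x : (f - g) x = f x - g x by [].
  by apply: eq_bigr => j _; rewrite !sub_fctE -/tr -/ti; ring.
have s1 := partial_L2sq_sub ar ai tr ti N eta0.
have s2 := partial_L2sq_sub tr ti ar ai N eta0.
have qMA := partial_L2sq_le ar ai M.
have qNA := partial_L2sq_le ar ai N.
rewrite qM in s1 s2.
have h1 : eta * partial_L2sq Omega ar ai M <= eta * A.
  by rewrite ler_wpM2l ?(ltW eta0) // (le_trans qMA).
have h2 : eta * partial_L2sq Omega ar ai N <= eta * A.
  by rewrite ler_wpM2l ?(ltW eta0) // (le_trans qNA).
have h3 := ler_wpM2l e2 (le_trans d1 tail).
have h4 := ler_wpM2l e2 d2.
rewrite ler_norml; apply/andP; split; lra.
Qed.

Lemma partial_L2sq_cvg ar ai (A : R) :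
  coef_sqsum ar ai @ \oo --> A ->
  exists L : R, partial_L2sq Omega ar ai @ \oo --> L.
Proof.
move=> cA.
have leA N : coef_sqsum ar ai N <= A.
  rewrite -(cvg_lim _ cA) //; apply: nondecreasing_cvgn_le.
    exact: coef_sqsum_nondecreasing.
  by apply/cvg_ex; exists A.
have A0 : 0 <= A.
  by apply: le_trans (leA 0%N); apply: sumr_ge0 => j _; rewrite addr_ge0 ?sqr_ge0.
suff : cvg (partial_L2sq Omega ar ai @ \oo) by move=> /cvg_ex.
apply/cauchy_cvgP/cauchy_exP => e e0.
(* This makes [eta * A <= e / 4], with [A + 1] covering the case [A = 0]; then [M] is taken so that
   the tail term is also at most [e / 4]. *)
pose eta := e / (4 * (A + 1)).
have eta0 : 0 < eta by rewrite divr_gt0 // mulr_gt0 // ltr_wpDl.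
have etaA : eta * A <= e / 4.
  rewrite /eta mulrAC ler_pdivrMr ?mulr_gt0 ?ltr_wpDl //.
  have -> : e / 4 * (4 * (A + 1)) = e * (A + 1) by field.
  by rewrite ler_wpM2l ?(ltW e0) // lerDl.
have K0 : 0 < 1 + eta^-1 by rewrite addr_gt0 // invr_gt0.
have e4 : 0 < e / 4 / (1 + eta^-1) by rewrite !divr_gt0.
have /cvgrPdist_le /(_ _ e4) [M _ Mn] := cA.
have := Mn M (leqnn M) => /=; rewrite ger0_norm ?subr_ge0 // ler_pdivlMr // => AM.
exists (partial_L2sq Omega ar ai M), M => // N MN /=.
rewrite /ball /= (le_lt_trans (partial_L2sq_dist eta0 MN (leA N))) //.
rewrite [_ * (A - _)]mulrC; lra.
Qed.

End OnOmega.

(** The coefficients vanish off [Gamma], so the sum may run over all integers, and each finite set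
    of integers lies in a symmetric window. *)
Lemma esum_coef (Gamma : set int) ar ai :
  (forall k, ~ Gamma k -> ar k = 0 /\ ai k = 0) ->
  (l2sq Gamma ar ai < +oo)%E ->
  exists2 A : R, l2sq Gamma ar ai = A%:E & coef_sqsum ar ai @ \oo --> A.
Proof.
move=> a0 fin.
pose f k : \bar R := (ar k ^+ 2 + ai k ^+ 2)%:E.
have f0 k : (0 <= f k)%E by rewrite lee_fin addr_ge0 ?sqr_ge0.
have l2E : l2sq Gamma ar ai = (\esum_(k in setT) f k)%E.
  rewrite /l2sq esum_mkcond; apply: eq_esum => k _; case: ifPn => //.
  by rewrite notin_setE => /a0[ar0 ai0]; rewrite /f ar0 ai0 expr0n addr0.
pose r N := [seq (j%:Z - N%:Z)%R | j <- index_iota 0 N.*2.+1].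
have ru N : uniq (r N).
  by rewrite map_inj_in_uniq ?iota_uniq // => i j _ _; lia.
have rE N : (\sum_(k \in [set` r N]) f k = (coef_sqsum ar ai N)%:E)%E.
  by rewrite -fsbig_seq // /r big_map sumEFin.
have Aub N : ((coef_sqsum ar ai N)%:E <= l2sq Gamma ar ai)%E.
  rewrite l2E; apply: esum_ge; exists [set` r N]; last by rewrite rE.
  by split => //; exact: finite_seq.
have l2fin : l2sq Gamma ar ai \is a fin_num.
  by rewrite ge0_fin_numE // l2E esum_ge0.
have cA : coef_sqsum ar ai @ \oo --> lim (coef_sqsum ar ai @ \oo).
  apply: nondecreasing_is_cvgn; first exact: coef_sqsum_nondecreasing.
  exists (fine (l2sq Gamma ar ai)) => _ [N _ <-].
  by rewrite -lee_fin fineK.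
exists (lim (coef_sqsum ar ai @ \oo)) => //.
have leA N : coef_sqsum ar ai N <= lim (coef_sqsum ar ai @ \oo).
  apply: nondecreasing_cvgn_le; first exact: coef_sqsum_nondecreasing.
  by apply/cvg_ex; eexists; exact: cA.
apply/le_anti/andP; split; last first.
  rewrite -(fineK l2fin) lee_fin; apply: limr_le.
    by apply/cvg_ex; eexists; exact: cA.
  by apply: nearW => N; rewrite -lee_fin fineK.
rewrite l2E; apply: ub_ereal_sup => _ [X [finX _] <-].
have /finite_seqP[u Xu] := finX.
pose N := (\max_(k <- u) `|k|)%N.
apply: (@le_trans _ _ (\sum_(k \in [set` r N]) f k)%E); last first.
  by rewrite rE lee_fin.
apply: lee_fsum_nneg_subset => //; first exact: finite_seq.
move=> k; rewrite inE Xu /= => ku.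
have kN : (`|k| <= N)%N.
  by rewrite /N; apply: leq_bigmax_seq.
rewrite inE /=; apply/mapP; exists `|(k + N%:Z)%R|%N; last by lia.
by rewrite mem_index_iota; lia.
Qed.

End PartialSums.

(** * Density of a periodic set *)

Section Density.
Variables (R : realType) (m' : nat) (sigma : {set 'I_m'.+1}).
Local Notation m := m'.+1.

Definition periodic_set : set int := [set k | residue m' k \in sigma].

Let chi (k : int) : R := if `[< periodic_set k >] then 1 else 0.
Let cnt (lo : int) (n : nat) : R := \sum_(0 <= i < n) chi (lo + i%:Z).

Lemma cnt_add lo a b : cnt lo (a + b) = cnt lo a + cnt (lo + a%:Z) b.
Proof.
rewrite /cnt (big_cat_nat _ (leq_addr b a)) //=; congr (_ + _).
rewrite -{1}[a]add0n big_addn addKn; apply: eq_bigr => i _.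
by congr chi; rewrite -addrA; congr (_ + _); lia.
Qed.

(** Any [m] consecutive integers meet every residue class exactly once. *)
Lemma cnt_block lo : cnt lo m = #|sigma|%:R.
Proof.
have inj : injective (fun i : 'I_m => residue m' (lo + i%:Z)).
  move=> i j /(congr1 (fun a : 'I_m => (a : nat)%:Z)); rewrite !residueE => /eqP.
  rewrite eqz_modDl !modz_nat !modn_small ?ltn_ord // => /eqP [] ij.
  exact: val_inj.
rewrite /cnt big_mkord -sum1_card natr_sum [RHS]big_mkcond /= [RHS](reindex_inj inj) /=.
apply: eq_bigr => i _; rewrite /chi.
by case: asboolP => [/= ->//|/negP/negPf ->].
Qed.

Lemma cnt_bounds lo n : 0 <= cnt lo n <= n%:R.
Proof.
rewrite sumr_ge0 /= => [|i _]; last by rewrite /chi; case: ifP.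
rewrite (@le_trans _ _ (\sum_(0 <= i < n) 1)) ?ler_sum // => [i _|].
  by rewrite /chi; case: ifP.
by rewrite sumr_const_nat subn0.
Qed.

Lemma cnt_muln lo q : cnt lo (m * q) = q%:R * #|sigma|%:R.
Proof.
elim: q => [|q IH]; first by rewrite muln0 /cnt big_geq // mul0r.
by rewrite mulnSr cnt_add IH cnt_block -natr1 mulrDl mul1r.
Qed.

Lemma card_sigma_le : (#|sigma|%:R : R) <= m%:R.
Proof. by rewrite ler_nat (leq_trans (max_card _)) // card_ord. Qed.

(** Full blocks are counted exactly; only the incomplete last block contributes an error. *)
Lemma cnt_dist lo n : `|cnt lo n - n%:R * (#|sigma|%:R / m%:R)| <= m%:R.
Proof.
have m0 : 0 < (m%:R : R) by rewrite ltr0n.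
rewrite {1 2}(divn_eq n m) mulnC cnt_add cnt_muln.
have /andP[c0 c1] := cnt_bounds (lo + (m * (n %/ m))%N%:Z) (n %% m).
move: c0 c1; set c := cnt _ (n %% m) => c0 c1.
have rm : ((n %% m)%:R : R) <= m%:R by rewrite ler_nat ltnW // ltn_mod.
set D := #|sigma|%:R / m%:R.
have D0 : 0 <= D by rewrite divr_ge0.
have D1 : D <= 1 by rewrite ler_pdivrMr // mul1r card_sigma_le.
have sE : #|sigma|%:R = m%:R * D :> R by rewrite mulrC divfK // gt_eqF.
rewrite natrD natrM {1}sE.
have -> : (n %/ m)%:R * (m%:R * D) + c - (m%:R * (n %/ m)%:R + (n %% m)%:R) * D =
  c - (n %% m)%:R * D by ring.
have rD0 : 0 <= (n %% m)%:R * D by rewrite mulr_ge0.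
have rD1 : (n %% m)%:R * D <= (n %% m)%:R.
  by rewrite -[leRHS]mulr1 ler_wpM2l.
rewrite ler_norml; apply/andP; split; lra.
Qed.

Lemma count_in_dist (x r : R) : 1 <= r ->
  `|count_in periodic_set x r - r * (#|sigma|%:R / m%:R)| <= m%:R + 1.
Proof.
move=> r1; rewrite /count_in; set n := absz _.
have /andP[f1 f2] := floor_itv (x + r).
have /andP[c1 c2] := ceil_itv x.
rewrite intrD in f2; rewrite intrB in c1.
have nE : (n%:R : R) = (Num.floor (x + r))%:~R - (Num.ceil x)%:~R + 1.
  (* For [r >= 1] the maximum with 0 in [count_in] has no effect; the number [n] of integers in the
     window is then within 1 of [r]. *)
  have pos : 0 <= Num.floor (x + r) - Num.ceil x + 1.
    by rewrite -(ler_int R) intrD intrB; lra.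
  have -> : (n%:R : R) = (n%:Z)%:~R by [].
  by rewrite /n (max_idPr pos) gez0_abs // intrD intrB.
have := cnt_dist (Num.ceil x) n; rewrite -/(cnt _ _).
set D := #|sigma|%:R / m%:R.
have D0 : 0 <= D by rewrite divr_ge0.
have D1 : D <= 1 by rewrite ler_pdivrMr ?ltr0n // mul1r card_sigma_le.
have nr1 : n%:R - r <= 1 by rewrite nE; lra.
have nr2 : -1 <= n%:R - r by rewrite nE; lra.
have h1 : (n%:R - r) * D <= 1 by rewrite (le_trans (ler_wpM2r D0 nr1)) // mul1r.
have h2 : -1 <= (n%:R - r) * D.
  by rewrite (le_trans _ (ler_wpM2r D0 nr2)) // mulN1r lerN2.
rewrite !ler_norml => /andP[d1 d2].
rewrite mulrBl in h1; rewrite mulrBl in h2.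
apply/andP; split; lra.
Qed.

Lemma cvg_div_dist (u : R -> R) (D K : R) :
  (forall r, 1 <= r -> `|u r - r * D| <= K) ->
  (fun r => u r / r) @ +oo --> D.
Proof.
move=> uK; apply/cvgrPdist_le => e e0; near=> r.
have r1 : 1 <= r by near: r; apply: nbhs_pinfty_ge; rewrite num_real.
have re : K / e <= r by near: r; apply: nbhs_pinfty_ge; rewrite num_real.
have r0 : 0 < r by rewrite (lt_le_trans _ r1).
have -> : D - u r / r = - ((u r - r * D) / r) by field; rewrite gt_eqF.
rewrite normrN normrM normfV (gtr0_norm r0) ler_pdivrMr //.
by rewrite (le_trans (uK _ r1)) // mulrC -ler_pdivrMr.
Unshelve. all: by end_near. Qed.

(** The counting error is bounded uniformly in [x], hence passes to the infimum and the supremum,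
    and division by [r] removes it in the limit. *)
Lemma periodic_set_density :
  has_uniform_density periodic_set (#|sigma|%:R / m%:R : R).
Proof.
set D := #|sigma|%:R / m%:R.
have cd r x : 1 <= r -> r * D - (m%:R + 1) <= count_in periodic_set x r
    <= r * D + (m%:R + 1).
  move=> r1; have := count_in_dist x r1; rewrite ler_norml -/D => /andP[h1 h2].
  by apply/andP; split; lra.
split; apply: (@cvg_div_dist _ _ (m%:R + 1)) => r r1;
  rewrite ler_norml lerBrDr lerBlDr [- _ + _]addrC [_ + r * D]addrC.
- apply/andP; split.
  + apply: lb_le_inf; first by exists (count_in periodic_set 0 r), 0.
    by move=> _ [x _ <-]; have /andP[] := cd r x r1.
  + apply: (@le_trans _ _ (count_in periodic_set 0 r)); last first.
      by have /andP[] := cd r 0 r1.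
    apply: ge_inf; last by exists 0.
    by exists (r * D - (m%:R + 1)) => _ [x _ <-]; have /andP[] := cd r x r1.
- apply/andP; split; last first.
  + apply: ge_sup; first by exists (count_in periodic_set 0 r), 0.
    by move=> _ [x _ <-]; have /andP[] := cd r x r1.
  + apply: (@le_trans _ _ (count_in periodic_set 0 r)).
      by have /andP[] := cd r 0 r1.
    apply: ub_le_sup; last by exists 0.
    by exists (r * D + (m%:R + 1)) => _ [x _ <-]; have /andP[] := cd r x r1.
Qed.

End Density.

(** * Choice of the parameters *)

Section Budget.
Variable R : realType.

(* This says that a barrier moving from [- (1 - r) / r] to [(1 - r) ^+ 2 * x] in
   [m * (1 - y)] equal steps satisfies [delta * Phi < 1]. For [X = x] and
   [y = r ^+ 2 * x] the two sides differ by [kappa], which absorbs the loss in the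
   inner approximation of [Omega] and the rounding of the density. *)
Lemma barrier_budget (r x X y : R) : 0 < r < 1 -> 0 < x <= 1 ->
  let kappa := x ^+ 2 * r ^+ 2 * (1 - r) in
  x - kappa / 4 <= X -> y <= r ^+ 2 * x + kappa / 4 ->
  (1 - X * r) * (1 + r * (1 - r) * x) < 1 - y.
Proof.
move=> /andP[r0 r1] /andP[x0 x1] kappa Xx yx.
have kappa0 : 0 < kappa by rewrite !mulr_gt0 ?exprn_gt0 // subr_gt0.
set s := r * (1 - r) * x.
have s0 : 0 <= s by rewrite !mulr_ge0 ?subr_ge0 // ltW.
have s1 : s <= 1.
  by rewrite /s -mulrA mulr_ile1 ?mulr_ge0 ?mulr_ile1 ?subr_ge0 ?gerBl // ltW.
have h1 : (1 - X * r) * (1 + s) <= (1 - (x - kappa / 4) * r) * (1 + s).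
  rewrite ler_wpM2r ?addr_ge0 // lerD2l lerN2 ler_wpM2r // ltW //.
(* The gain comes from [(1 - x r) (1 + s) = 1 - r^2 x - kappa]. Replacing [x] by [X] costs at most
   [kappa / 2], and [y] costs at most [kappa / 4]. *)
have h2 : (1 - (x - kappa / 4) * r) * (1 + s) =
    1 - r ^+ 2 * x - kappa + kappa / 4 * (r * (1 + s)).
  by rewrite /s /kappa; field.
have h3 : r * (1 + s) <= 2.
  rewrite (@le_trans _ _ (1 * (1 + s))) ?ler_wpM2r ?addr_ge0 ?(ltW r1) //; lra.
have h4 : kappa / 4 * (r * (1 + s)) <= kappa / 4 * 2.
  by rewrite ler_wpM2l // divr_ge0 // ltW.
lra.
Qed.

Lemma open_measure_gt0 (Omega : set R) : open Omega -> Omega !=set0 ->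
  (0 < lebesgue_measure Omega)%E.
Proof.
move=> oO [t tO]; have [e /= e0 eO] : nbhs_ball t Omega.
  by apply/nbhs_ballP; move: oO; rewrite openE => /(_ _ tO).
apply: (@lt_le_trans _ _ (lebesgue_measure (ball t e))).
  by rewrite lebesgue_measure_ball ?ltW // lte_fin pmulrn_lgt0.
apply: le_measure; rewrite ?inE //; last exact: open_measurable.
by apply: open_measurable; exact: ball_open.
Qed.

End Budget.

Theorem theorem5 (R : realType) (d : R) (hd0 : 0 < d) (hd1 : d < 1)
  (Omega : set R) (hopen : open Omega) (hsub : Omega `<=` `[0, 2 * pi]%classic)
  (hne : Omega !=set0) :
  exists (Gamma : set int) (D : R),
    has_uniform_density Gamma D /\ (1 - d) * nmeasure Omega < D /\
    forall ar ai : int -> R,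
      (forall k, ~ Gamma k -> ar k = 0 /\ ai k = 0) ->
      (l2sq Gamma ar ai < +oo)%E ->
      exists L : R,
        partial_L2sq Omega ar ai @ \oo --> L /\
        (((1 - Num.sqrt (1 - d)) ^+ 2 * nmeasure Omega)%:E * l2sq Gamma ar ai
          <= L%:E)%E.
Proof.
have pi2 : 0 < 2 * pi :> R by rewrite mulr_gt0 // pi_gt0.
have [r rE] : exists r : R, r = Num.sqrt (1 - d) by eexists.
have [x xE] : exists x : R, x = nmeasure Omega by eexists.
rewrite -rE -xE.
have r2 : 1 - d = r ^+ 2 by rewrite rE sqr_sqrtr // subr_ge0 ltW.
have r0 : 0 < r by rewrite rE sqrtr_gt0 subr_gt0.
have r1 : r < 1 by rewrite -(ltr_pXn2r (n := 2)) ?nnegrE ?ltW // -r2 expr1n gtrBl.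
have mufin := measure_open_fin pi2 hopen hsub.
have x0 : 0 < x.
  by rewrite xE divr_gt0 // -lte_fin fineK // open_measure_gt0.
have x1 : x <= 1.
  by rewrite xE ler_pdivrMr // mul1r -lee_fin fineK // measure_open_le.
pose kappa := x ^+ 2 * r ^+ 2 * (1 - r).
have r1' : 0 < 1 - r by rewrite subr_gt0.
have kappa0 : 0 < kappa by rewrite !mulr_gt0 // exprn_gt0.
have [|m0 inner] := @inner_cells R Omega (2 * pi) pi2 hopen hsub (2 * pi * (kappa / 4)).
  by rewrite mulr_gt0 // divr_gt0.
(* Large enough for the inner approximation, and for [1 / m <= kappa / 4], the cost of rounding the
   density. *)
pose m' := maxn m0 (Num.truncn (4 / kappa)); pose m := m'.+1.
have mp : 0 < (m%:R : R) by rewrite ltr0n.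
have mk : m%:R^-1 <= kappa / 4.
  rewrite -[kappa / 4]invrK lef_pV2 ?posrE ?invr_gt0 ?divr_gt0 // invf_div ltW //.
  have /andP[_ h] := truncn_itv (ltW (divr_gt0 (ltr0Sn R 3) kappa0)).
  by rewrite (lt_le_trans h) // ler_nat ltnS leq_maxr.
have [||E [EO Ex]] := inner m; [by rewrite leqW // leq_maxl | by [] |].
pose X := #|E|%:R / m%:R : R.
have Xx : x - kappa / 4 <= X.
  rewrite -(ler_pM2l pi2) mulrBr (_ : 2 * pi * x = fine (lebesgue_measure Omega)).
    by rewrite (le_trans Ex) // /X mulrAC mulrA.
  by rewrite xE /nmeasure mulrC divfK // gt_eqF.
(* The least integer strictly above [r^2 x m], so that the density [l / m] strictly exceeds
   [(1 - d) x]. *)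
pose l := (Num.truncn (r ^+ 2 * x * m%:R)).+1.
have rxm : 0 <= r ^+ 2 * x * m%:R by rewrite !mulr_ge0 ?sqr_ge0 // ltW.
have /andP[l1 l2] := truncn_itv rxm.
pose y := l%:R / m%:R : R.
have y1 : r ^+ 2 * x < y by rewrite ltr_pdivlMr.
have y2 : y <= r ^+ 2 * x + kappa / 4.
  rewrite ler_pdivrMr // mulrDl /l -natr1 lerD //.
  by rewrite -ler_pdivrMr // mul1r.
have budget : (1 - X * r) * (1 + r * (1 - r) * x) < 1 - y.
  by apply: barrier_budget; rewrite ?r0 ?r1 ?x0 ?x1.
have X1 : X <= 1.
  by rewrite ler_pdivrMr // mul1r ler_nat (leq_trans (max_card _)) // card_ord.
(* The left side of [budget] is nonnegative, so at least one index remains to be deleted. *)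
have y_lt1 : y < 1.
  rewrite -subr_gt0 (le_lt_trans _ budget) // mulr_ge0 //.
    by rewrite subr_ge0 mulr_ile1 // ?divr_ge0 // ltW.
  by rewrite addr_ge0 // !mulr_ge0 ?subr_ge0 // ltW.
have lm : (l < m)%N by rewrite -(ltr_nat R) -[ltRHS]mul1r -ltr_pdivrMr.
pose b := (1 - r) ^+ 2 * x.
pose beta := (1 - r) / r.
(* Equal steps that bring the barrier from [- beta] to [b] in [m - l] deletions. *)
pose delta := (beta + b) / (m - l)%:R.
have mlp : 0 < ((m - l)%:R : R) by rewrite ltr0n subn_gt0.
have mlE : (m - l)%:R = m%:R * (1 - y) :> R.
  by rewrite natrB 1?ltnW // mulrBr mulr1 /y mulrC divfK // gt_eqF.
have beta0 : 0 < beta by rewrite divr_gt0 // subr_gt0.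
have b0 : 0 <= b by rewrite mulr_ge0 ?sqr_ge0 // ltW.
have delta0 : 0 <= delta by rewrite divr_ge0 ?addr_ge0 // ltW.
have dPhi : delta * (#|E|%:R / (1 + beta) + (m%:R - #|E|%:R) / beta) < 1.
  have -> : #|E|%:R = m%:R * X :> R by rewrite mulrC divfK // gt_eqF.
  (* As [1 + beta = 1 / r], the bracket is [m r (1 - X r) / (1 - r)], while
     [(beta + b) r / (1 - r) = 1 + r (1 - r) x]. *)
  have -> : delta * (m%:R * X / (1 + beta) + (m%:R - m%:R * X) / beta) =
      (1 - X * r) * (1 + r * (1 - r) * x) / (1 - y).
    rewrite /delta mlE /b /beta; field.
    rewrite ?(gt_eqF r0) ?(gt_eqF mp) ?subr_eq0 ?(gt_eqF r1) ?(gt_eqF y_lt1) //=.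
    by rewrite andbT addrC subrK oner_eq0.
  by rewrite ltr_pdivrMr ?subr_gt0 // mul1r.
have [sigma [cs band]] := band_selection beta0 delta0 dPhi (leq_subr l m).
have csl : #|sigma| = l by rewrite cs subKn // ltnW.
have bE : (m - l)%:R * delta - beta = b.
  by rewrite /delta mulrC divfK ?gt_eqF // addrC addKr.
exists (periodic_set sigma), y; split.
  by rewrite /y -csl; exact: periodic_set_density.
split; first by rewrite r2.
move=> ar ai a0 fin.
have [A l2E cA] := esum_coef a0 fin.
have [L cL] := partial_L2sq_cvg hopen hsub cA.
exists L; split => //; rewrite l2E -EFinM lee_fin -/b.
(* The inequality holds for every partial sum with the same constant [b], so it passes to the
   limit. *)
apply: (@ler_cvg_to _ _ _ R (fun N => b * coef_sqsum ar ai N) _ _ _ _ cL).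
  by apply: cvgMr.
apply: nearW => N; apply: (partial_L2sq_ge hopen hsub EO) => t.
rewrite -bE; apply: band => k ks; apply: a0 => /= Gk.
by rewrite Gk in ks.
Qed.
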